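(* Let $1/3<\alpha<1$ and $s,t\in\mathbb{R}$. Then the function $$f(z)=z\,{}_2F_1(s+it,s-it;2s+1;z),\quad z\in\mathbb{D},$$ is strongly starlike of order $\alpha$ if $(s,t)$ is contained in the closed ellipse given by $$\left(s-2\sin^2\frac{\pi\alpha}{2}\right)^2+\frac13\left(4\sin^2\frac{\pi\alpha}{2}-1\right)t^2\le\sin^2\frac{\pi\alpha}{2}\left(4\sin^2\frac{\pi\alpha}{2}-1\right).$$
   Context: $\mathbb{D}=\{z\in\mathbb{C}:|z|<1\}$. For $a,b,c\in\mathbb{C}$ with $c\ne0,-1,-2,\dots$, the Gaussian hypergeometric function is ${}_2F_1(a,b;c;z)=\sum_{n=0}^\infty\frac{(a)_n(b)_n}{(c)_n n!}z^n$ for $z\in\mathbb{D}$, where $(a)_0=1$ and $(a)_n=a(a+1)\cdots(a+n-1)$. For $\alpha\in(0,1)$, an analytic function $f$ on $\mathbb{D}$ with $f(0)=0$, $f'(0)=1$ is called strongly starlike of order $\alpha$ if $\left|\arg\frac{zf'(z)}{f(z)}\right|<\frac{\pi}{2}\alpha$ for all $z\in\mathbb{D}$ (the quotient taking the value $1$ at $z=0$). *)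

(* Defs.v *)
From Stdlib Require Import Reals Lra Factorial.
From Coquelicot Require Import Coquelicot.

Open Scope R_scope.

(* Sum of a complex series; the value is meaningful only when the series
   converges, see [CSeries_unique]. *)
Definition CSeries (u : nat -> C) : C :=
  (Series (fun n => Re (u n)), Series (fun n => Im (u n))).

Lemma CSeries_unique (u : nat -> C) (l : C) : is_series u l -> CSeries u = l.
Proof.
intros H.
assert (HR : forall n, Re (sum_n u n) = sum_n (fun k => Re (u k)) n).
{ induction n as [|n IH]; [now rewrite !sum_O|].
  rewrite !sum_Sn, <- IH; reflexivity. }
assert (HI : forall n, Im (sum_n u n) = sum_n (fun k => Im (u k)) n).
{ induction n as [|n IH]; [now rewrite !sum_O|].
  rewrite !sum_Sn, <- IH; reflexivity. }
unfold CSeries; destruct l as [x y]; f_equal; apply is_series_unique.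
- apply (filterlim_ext (fun n => Re (sum_n u n))); [exact HR|].
  apply filterlim_locally; intros eps.
  generalize (proj1 (filterlim_locally _ _) H eps); apply filter_imp.
  intros n Hn; exact (proj1 Hn).
- apply (filterlim_ext (fun n => Im (sum_n u n))); [exact HI|].
  apply filterlim_locally; intros eps.
  generalize (proj1 (filterlim_locally _ _) H eps); apply filter_imp.
  intros n Hn; exact (proj2 Hn).
Qed.

Fixpoint pochhammer (a : C) (n : nat) : C :=
  match n with
  | O => RtoC 1
  | S m => (pochhammer a m * (a + RtoC (INR m)))%C
  end.

(* Meaningful for [c] different from 0, -1, -2, ... and [Cmod z < 1]. *)
Definition hyp2F1 (a b c z : C) : C :=
  CSeries (fun n =>
    (pochhammer a n * pochhammer b n
       / (pochhammer c n * RtoC (INR (fact n))) * z ^ n)%C).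

(* Principal argument, with values in (-PI, PI]; see [Carg_spec].  The value
   at 0 is a dummy one. *)
Definition Carg (z : C) : R :=
  if Rle_dec 0 (Im z) then acos (Re z / Cmod z) else - acos (Re z / Cmod z).

Lemma Carg_spec (z : C) : z <> RtoC 0 ->
  - PI < Carg z <= PI /\
  Re z = Cmod z * cos (Carg z) /\ Im z = Cmod z * sin (Carg z).
Proof.
intros Hz.
assert (Hm : 0 < Cmod z) by (now apply Cmod_gt_0).
assert (H2 := Cmod2_alt z).
assert (Hre := re_le_Cmod z).
set (x := Re z / Cmod z).
assert (Hx : Re z = Cmod z * x) by (unfold x; field; lra).
assert (Hx1 : -1 <= x <= 1).
{ apply Rabs_le_between in Hre; split; nra. }
assert (Hb := acos_bound x).
assert (Hs : Cmod z * sqrt (1 - Rsqr x) = Rabs (Im z)).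
{ rewrite <- (sqrt_Rsqr (Cmod z)) at 1 by lra.
  rewrite <- sqrt_mult_alt by apply Rle_0_sqr.
  rewrite <- sqrt_Rsqr_abs; f_equal; unfold Rsqr; rewrite Hx in H2; nra. }
unfold Carg; fold x.
destruct (Rle_dec 0 (Im z)) as [Hi|Hi].
- rewrite cos_acos, sin_acos, Hs, Rabs_right by lra.
  generalize PI_RGT_0; intros; repeat split; lra.
- rewrite cos_neg, sin_neg, cos_acos, sin_acos by lra.
  rewrite Ropp_mult_distr_r_reverse, Hs, Rabs_left by lra.
  repeat split; try lra.
  destruct (Req_dec (acos x) PI) as [E|E]; [exfalso|lra].
  assert (Ex : x = -1) by (rewrite <- (cos_acos x), E by lra; apply cos_PI).
  rewrite Ex in Hs; unfold Rsqr in Hs.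
  replace (1 - -1 * -1) with 0 in Hs by ring.
  rewrite sqrt_0, Rabs_left in Hs; lra.
Qed.

Definition analytic_on_disk (f : C -> C) : Prop :=
  forall z : C, Cmod z < 1 -> ex_derive f z.

(* z f'(z) / f(z), with the value 1 at z = 0. *)
Definition starlike_quotient (f : C -> C) (z : C) : C :=
  if Ceq_dec z (RtoC 0) then RtoC 1 else (z * C_derive f z / f z)%C.

(* The conditions [f z <> 0] and [starlike_quotient f z <> 0] make explicit
   that the quotient and its argument are defined. *)
Definition strongly_starlike (alpha : R) (f : C -> C) : Prop :=
  analytic_on_disk f /\
  f (RtoC 0) = RtoC 0 /\
  C_derive f (RtoC 0) = RtoC 1 /\
  forall z : C, Cmod z < 1 ->
    (z <> RtoC 0 -> f z <> RtoC 0) /\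
    starlike_quotient f z <> RtoC 0 /\
    Rabs (Carg (starlike_quotient f z)) < PI / 2 * alpha.

(* Main.v *)
Require Import Defs.
From Stdlib Require Import Reals Lra Lia Factorial Classical ClassicalEpsilon.
From Coquelicot Require Import Coquelicot.

(* Write F for the hypergeometric function, f = z F, th = PI alpha / 2 and
   p = z f' / f = 1 + z F' / F.  The sector |arg p| < th is the intersection of
   two half-planes through 0; reflecting 1 in the boundary of one of them turns
   it into |z F'| < |z F' + lam F| with lam = 1 - exp (2 i th) (the other one is
   obtained from - th).  Suppose that this fails, and let z0 be a point of least
   modulus where it does.  By the maximum principle for F' / (z F' + lam F)
   (Schwarz' lemma), z w' / w is real and at least 1 at z0 for
   w = z F' / (z F' + lam F).  With the hypergeometric equation, which for
   c = a + b + 1 reads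
     z q' + q^2 + 2 s q = (s^2 + t^2) z / (1 - z),   q = z F' / F,
   and Re (z / (1 - z)) > - 1 / 2, this gives
     |q|^2 / 2 < Re (q^2) + 2 s Re q + (s^2 + t^2) / 2
   for some q on the line {rho exp (i th) - 1}.  The ellipse is exactly the set
   of (s, t) for which no real rho satisfies this. *)

Open Scope R_scope.

(** * Complex derivatives *)

(** Trades filters for increments in [h], the form in which the estimates for inverses, power series
    and paths are carried out. *)
Lemma is_C_derive_iff (f : C -> C) (z l : C) :
  is_derive f z l <->
  forall eps, 0 < eps -> exists delta, 0 < delta /\ forall h : C, Cmod h < delta ->
    Cmod (f (z + h) - f z - l * h)%C <= eps * Cmod h.
Proof.
split.
- intros [_ H] eps Heps.
  destruct (H z (fun P HP => HP) (mkposreal eps Heps)) as [d Hd].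
  exists d; split; [apply cond_pos|]; intros h Hh.
  specialize (Hd (z + h)%C).
  change (Cmod (z + h - z)%C < d -> Cmod (f (z + h) - f z - (z + h - z) * l)%C
          <= eps * Cmod (z + h - z)%C) in Hd.
  replace (z + h - z)%C with h in Hd by ring.
  rewrite (Cmult_comm l); auto.
- intros H; split; [apply is_linear_scal_l|].
  intros x; change C in (type of x); intros Hx.
  replace x with z
    by exact (@is_filter_lim_locally_unique _ (AbsRing_NormedModule C_AbsRing) _ _ Hx).
  intros eps; destruct (H eps (cond_pos eps)) as [d [Hd0 Hd]].
  exists (mkposreal d Hd0); intros y; change C in (type of y); intros Hy.
  specialize (Hd (y - z)%C Hy).
  replace (z + (y - z))%C with y in Hd by ring.
  rewrite (Cmult_comm l) in Hd; exact Hd.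
Qed.

(* [is_derive] on [C -> C] can be elaborated with two normed module structures
   on the codomain. *)
Lemma is_C_derive_AbsRing (f : C -> C) (z l : C) :
  @is_derive C_AbsRing C_NormedModule f z l <->
  @is_derive C_AbsRing (AbsRing_NormedModule C_AbsRing) f z l.
Proof.
split; intros [_ H]; (split; [apply is_linear_scal_l | exact H]).
Qed.

Lemma is_C_derive_mult (f g : C -> C) (z df dg : C) :
  is_derive f z df -> is_derive g z dg ->
  is_derive (fun x => f x * g x)%C z (df * g z + f z * dg)%C.
Proof.
intros Hf Hg.
apply is_C_derive_AbsRing in Hf; apply is_C_derive_AbsRing in Hg.
apply is_C_derive_AbsRing.
exact (@is_derive_mult C_AbsRing f g z df dg Hf Hg Cmult_comm).
Qed.

Lemma is_C_derive_id (z : C) : is_derive (fun x : C => x) z (RtoC 1).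
Proof. apply is_C_derive_AbsRing; exact (@is_derive_id C_AbsRing z). Qed.

Definition ccont (f : C -> C) (z : C) : Prop :=
  forall eps, 0 < eps -> exists delta, 0 < delta /\
    forall h : C, Cmod h < delta -> Cmod (f (z + h) - f z)%C < eps.

Lemma is_C_derive_ccont (f : C -> C) (z l : C) : is_derive f z l -> ccont f z.
Proof.
intros H eps Heps; rewrite is_C_derive_iff in H.
destruct (H 1 Rlt_0_1) as [d [Hd0 Hd]].
assert (Hl := Cmod_ge_0 l).
exists (Rmin d (eps / (2 + Cmod l))); split.
{ apply Rmin_glb_lt; [assumption|]; apply Rdiv_lt_0_compat; lra. }
intros h Hh.
assert (H1 := Rlt_le_trans _ _ _ Hh (Rmin_l _ _)).
assert (H2 := Rlt_le_trans _ _ _ Hh (Rmin_r _ _)).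
apply Rlt_div_r in H2; [|lra].
replace (f (z + h) - f z)%C with ((f (z + h) - f z - l * h) + l * h)%C by ring.
assert (H3 := Cmod_triangle (f (z + h) - f z - l * h)%C (l * h)%C).
rewrite Cmod_mult in H3; specialize (Hd h H1).
assert (H4 := Cmod_ge_0 h); nra.
Qed.

Lemma Cmod_minus_ge (x y : C) : Cmod x - Cmod (x - y) <= Cmod y.
Proof.
assert (H := Cmod_triangle (x - y) y).
replace (x - y + y)%C with x in H by ring; lra.
Qed.

Lemma is_C_derive_inv (f : C -> C) (z df : C) : is_derive f z df ->
  f z <> RtoC 0 -> is_derive (fun x => / f x)%C z (- df / (f z * f z))%C.
Proof.
intros Hf Hz; apply is_C_derive_iff; intros eps Heps.
assert (Hm : 0 < Cmod (f z)) by (now apply Cmod_gt_0).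
assert (Hdf := Cmod_ge_0 df).
assert (Hc := is_C_derive_ccont _ _ _ Hf).
set (m := Cmod (f z)) in *.
(* The numerator of the error is df h (f (z + h) - f z) - f z (f (z + h) - f z - df h). [e1] and the
   second entry of [e2] keep each term below eps m^3 / 4 times [Cmod h]; the entry m / 2 keeps the
   denominator above m^3 / 2. *)
set (e1 := eps * m ^ 2 / 4).
assert (Hm2 : 0 < eps * m ^ 2) by (apply Rmult_lt_0_compat; [|apply pow_lt]; lra).
assert (He1 : 0 < e1) by (unfold e1; lra).
set (e2 := Rmin (m / 2) (eps * m ^ 3 / (4 * (1 + Cmod df)))).
assert (He2 : 0 < e2).
{ apply Rmin_glb_lt; [lra|]; apply Rdiv_lt_0_compat; [|lra].
  apply Rmult_lt_0_compat; [lra|]; apply pow_lt; lra. }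
rewrite is_C_derive_iff in Hf.
destruct (Hf e1 He1) as [d1 [Hd1 H1]]; destruct (Hc e2 He2) as [d2 [Hd2 H2]].
exists (Rmin d1 d2); split; [now apply Rmin_glb_lt|]; intros h Hh.
specialize (H1 h (Rlt_le_trans _ _ _ Hh (Rmin_l _ _))).
specialize (H2 h (Rlt_le_trans _ _ _ Hh (Rmin_r _ _))).
assert (H2a := Rlt_le_trans _ _ _ H2 (Rmin_l _ _)).
assert (H2b := Rlt_le_trans _ _ _ H2 (Rmin_r _ _)).
assert (Hy : m / 2 < Cmod (f (z + h)%C)).
{ assert (H3 := Cmod_minus_ge (f z) (f (z + h)%C)).
  rewrite <- (Cmod_opp (f z - _)) in H3.
  replace (- (f z - f (z + h)))%C with (f (z + h) - f z)%C in H3 by ring.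
  fold m in H3; lra. }
assert (Hy0 : f (z + h)%C <> RtoC 0) by (apply Cmod_gt_0; lra).
replace (/ f (z + h) - / f z - - df / (f z * f z) * h)%C
  with ((df * h * (f (z + h) - f z) - f z * (f (z + h) - f z - df * h))
        / (f z * f z * f (z + h)))%C by (field; auto).
assert (Hn : (f z * f z * f (z + h))%C <> RtoC 0)
  by (repeat apply Cmult_neq_0; assumption).
rewrite Cmod_div by assumption; rewrite !Cmod_mult; fold m.
apply Rle_div_l; [apply Rmult_lt_0_compat; nra|].
apply Rle_trans with (Cmod h * (eps * m ^ 2 * (m / 2))).
2: { replace (eps * Cmod h * (m * m * Cmod (f (z + h)%C)))
       with (Cmod h * (eps * m ^ 2 * Cmod (f (z + h)%C))) by ring.
     assert (Hh0 := Cmod_ge_0 h).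
     apply Rmult_le_compat_l; [assumption|].
     apply Rmult_le_compat_l; lra. }
eapply Rle_trans; [apply Cmod_triangle|].
rewrite Cmod_opp, !Cmod_mult; fold m.
set (k := Cmod (f (z + h) - f z)%C) in *.
set (q := Cmod (f (z + h) - f z - df * h)%C) in *.
assert (Hk : Cmod df * k <= eps * m ^ 3 / 4).
{ assert (k * (1 + Cmod df) <= eps * m ^ 3 / 4).
  { replace (eps * m ^ 3 / 4)
      with (eps * m ^ 3 / (4 * (1 + Cmod df)) * (1 + Cmod df)) by (field; lra).
    apply Rmult_le_compat_r; lra. }
  assert (0 <= k) by apply Cmod_ge_0; nra. }
assert (Hq : m * q <= m * (e1 * Cmod h)) by (apply Rmult_le_compat_l; lra).
unfold e1 in Hq.
assert (Hh0 := Cmod_ge_0 h).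
assert (Cmod h * (Cmod df * k) <= Cmod h * (eps * m ^ 3 / 4))
  by (apply Rmult_le_compat_l; lra).
nra.
Qed.

Lemma is_C_derive_div (f g : C -> C) (z df dg : C) :
  is_derive f z df -> is_derive g z dg -> g z <> RtoC 0 ->
  is_derive (fun x => f x / g x)%C z ((df * g z - f z * dg) / (g z * g z))%C.
Proof.
intros Hf Hg Hz.
replace ((df * g z - f z * dg) / (g z * g z))%C
  with (df * / g z + f z * (- dg / (g z * g z)))%C by (field; assumption).
apply (is_C_derive_mult f (fun x => / g x)%C z _ _ Hf).
now apply is_C_derive_inv.
Qed.

Lemma is_C_derive_plus (f g : C -> C) (z df dg : C) :
  is_derive f z df -> is_derive g z dg -> is_derive (fun x => f x + g x)%C z (df + dg)%C.
Proof. exact (@is_derive_plus C_AbsRing C_NormedModule f g z df dg). Qed.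

Lemma is_C_derive_scal (f : C -> C) (k z df : C) :
  is_derive f z df -> is_derive (fun x => k * f x)%C z (k * df)%C.
Proof.
intros Hf; replace (k * df)%C with (0 * f z + k * df)%C by ring.
apply (is_C_derive_mult (fun _ => k) f); [|assumption].
apply is_C_derive_AbsRing, @is_derive_const.
Qed.

Lemma is_C_derive_id_mult (f : C -> C) (z df : C) :
  is_derive f z df -> is_derive (fun x => x * f x)%C z (f z + z * df)%C.
Proof.
intros Hf; replace (f z + z * df)%C with (1 * f z + z * df)%C by ring.
apply (is_C_derive_mult (fun x => x) f); [apply is_C_derive_id|assumption].
Qed.

(** * Complex power series *)

Lemma im_le_Cmod (z : C) : Rabs (Im z) <= Cmod z.
Proof. eapply Rle_trans; [apply Rmax_r|apply Rmax_Cmod]. Qed.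

Lemma ex_series_Re (u : nat -> C) :
  ex_series (fun n => Cmod (u n)) -> ex_series (fun n => Re (u n)).
Proof.
apply (@ex_series_le R_AbsRing R_CompleteNormedModule); intros n; apply re_le_Cmod.
Qed.

Lemma ex_series_Im (u : nat -> C) :
  ex_series (fun n => Cmod (u n)) -> ex_series (fun n => Im (u n)).
Proof.
apply (@ex_series_le R_AbsRing R_CompleteNormedModule); intros n; apply im_le_Cmod.
Qed.

Lemma CSeries_ext (u v : nat -> C) : (forall n, u n = v n) -> CSeries u = CSeries v.
Proof. intros H; unfold CSeries; f_equal; apply Series_ext; intros n; now rewrite H. Qed.

Lemma CSeries_plus (u v : nat -> C) :
  ex_series (fun n => Cmod (u n)) -> ex_series (fun n => Cmod (v n)) ->
  CSeries (fun n => u n + v n)%C = (CSeries u + CSeries v)%C.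
Proof.
intros Hu Hv; unfold CSeries, Cplus; simpl; f_equal.
- rewrite <- Series_plus; auto using ex_series_Re.
- rewrite <- Series_plus; auto using ex_series_Im.
Qed.

Lemma CSeries_scal (k : C) (u : nat -> C) :
  ex_series (fun n => Cmod (u n)) -> CSeries (fun n => k * u n)%C = (k * CSeries u)%C.
Proof.
intros Hu; assert (Hr := ex_series_Re _ Hu); assert (Hi := ex_series_Im _ Hu).
unfold CSeries, Cmult; simpl; f_equal.
- rewrite <- !Series_scal_l, <- Series_minus; auto.
  + now apply (@ex_series_scal R_AbsRing R_NormedModule (fst k) (fun n => Re (u n))).
  + now apply (@ex_series_scal R_AbsRing R_NormedModule (snd k) (fun n => Im (u n))).
- rewrite <- !Series_scal_l, <- Series_plus; auto.
  + now apply (@ex_series_scal R_AbsRing R_NormedModule (fst k) (fun n => Im (u n))).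
  + now apply (@ex_series_scal R_AbsRing R_NormedModule (snd k) (fun n => Re (u n))).
Qed.

Lemma ex_series_Cmod_scal (k : C) (u : nat -> C) :
  ex_series (fun n => Cmod (u n)) -> ex_series (fun n => Cmod (k * u n)%C).
Proof.
intros H; apply ex_series_ext with (fun n => Cmod k * Cmod (u n)).
- intros n; symmetry; apply Cmod_mult.
- now apply (@ex_series_scal R_AbsRing R_NormedModule).
Qed.

Lemma ex_series_Cmod_plus (u v : nat -> C) :
  ex_series (fun n => Cmod (u n)) -> ex_series (fun n => Cmod (v n)) ->
  ex_series (fun n => Cmod (u n + v n)%C).
Proof.
intros Hu Hv.
apply (@ex_series_le R_AbsRing R_CompleteNormedModule)
  with (fun n => Cmod (u n) + Cmod (v n)).
- intros n; change (Rabs (Cmod (u n + v n)%C) <= Cmod (u n) + Cmod (v n)).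
  rewrite Rabs_pos_eq by apply Cmod_ge_0; apply Cmod_triangle.
- now apply (@ex_series_plus R_AbsRing R_NormedModule).
Qed.

(** For the sum l, [Cmod l ^ 2] is the real part of the sum of conj l u_n, a real series dominated
    by [Cmod l] times the series of moduli; divide by [Cmod l] when it is nonzero. *)
Lemma CSeries_Cmod_le (u : nat -> C) (b : nat -> R) :
  (forall n, Cmod (u n) <= b n) -> ex_series b -> Cmod (CSeries u) <= Series b.
Proof.
intros Hub Hb.
assert (Hu : ex_series (fun n => Cmod (u n))).
{ apply (@ex_series_le R_AbsRing R_CompleteNormedModule) with b; [|assumption].
  intros n; change (Rabs (Cmod (u n)) <= b n).
  rewrite Rabs_pos_eq by apply Cmod_ge_0; apply Hub. }
assert (Hle : Series (fun n => Cmod (u n)) <= Series b).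
{ apply Series_le; [|assumption]; intros n; split; [apply Cmod_ge_0|apply Hub]. }
apply Rle_trans with (2 := Hle).
set (l := CSeries u).
assert (H : Cmod l ^ 2 <= Cmod l * Series (fun n => Cmod (u n))).
{ replace (Cmod l ^ 2) with (Re (Cconj l * l)%C).
  2: { rewrite Cmod2_alt; unfold Re, Im, Cconj, Cmult; simpl; ring. }
  unfold l at 2; rewrite <- CSeries_scal by assumption.
  simpl; rewrite <- Series_scal_l.
  eapply Rle_trans; [apply Rle_abs|].
  assert (Hex : ex_series (fun n => Cmod l * Cmod (u n)))
    by now apply (@ex_series_scal R_AbsRing R_NormedModule).
  assert (Hn : forall n, Rabs (Re (Cconj l * u n)%C) <= Cmod l * Cmod (u n)).
  { intros n; eapply Rle_trans; [apply re_le_Cmod|].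
    rewrite Cmod_mult, Cmod_conj; apply Rle_refl. }
  eapply Rle_trans; [apply Series_Rabs|apply Series_le].
  - apply (@ex_series_le R_AbsRing R_CompleteNormedModule)
      with (fun n => Cmod l * Cmod (u n)); [|assumption].
    intros n; change (Rabs (Rabs (Re (Cconj l * u n)%C)) <= Cmod l * Cmod (u n)).
    rewrite Rabs_Rabsolu; apply Hn.
  - intros n; split; [apply Rabs_pos|apply Hn].
  - assumption. }
destruct (Cmod_ge_0 l) as [Hl|Hl].
- apply Rmult_le_reg_l with (Cmod l); [assumption|].
  replace (Cmod l * Cmod l) with (Cmod l ^ 2) by ring; assumption.
- rewrite <- Hl.
  assert (H0 : Series (fun n => 0 * Cmod (u n)) <= Series (fun n => Cmod (u n))).
  { apply Series_le; [|assumption].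
    intros n; rewrite Rmult_0_l; split; [lra|apply Cmod_ge_0]. }
  rewrite Series_scal_l, Rmult_0_l in H0; assumption.
Qed.

Lemma CSeries_incr_1 (u : nat -> C) : ex_series (fun n => Cmod (u n)) ->
  CSeries u = (u O + CSeries (fun n => u (S n)))%C.
Proof.
intros H; unfold CSeries, Cplus; simpl; f_equal; apply Series_incr_1.
- now apply ex_series_Re.
- now apply ex_series_Im.
Qed.

Definition CPS (a : nat -> R) (z : C) : C := CSeries (fun n => RtoC (a n) * z ^ n)%C.

(* Nonnegativity makes [PSeries a] its own majorant: the complex remainder of
   [CPS a] is bounded by the real one of [PSeries a]. *)
Definition disk_coeffs (a : nat -> R) : Prop :=
  (forall n, 0 <= a n) /\ Rbar_le 1 (CV_radius a).

Lemma disk_coeffs_derive (a : nat -> R) : disk_coeffs a -> disk_coeffs (PS_derive a).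
Proof.
intros [H0 H1]; split; [|now rewrite CV_radius_derive].
intros n; apply Rmult_le_pos; [apply pos_INR|apply H0].
Qed.

Lemma disk_coeffs_radius (a : nat -> R) (x : R) : disk_coeffs a -> 0 <= x < 1 ->
  Rbar_lt (Rabs x) (CV_radius a).
Proof.
intros [_ H1] Hx; apply Rbar_lt_le_trans with 1; [|assumption].
simpl; rewrite Rabs_pos_eq; lra.
Qed.

Lemma disk_coeffs_ex_series (a : nat -> R) (x : R) : disk_coeffs a -> 0 <= x < 1 ->
  ex_series (fun n => a n * x ^ n).
Proof.
intros Ha Hx.
apply ex_series_Rabs, CV_disk_inside, disk_coeffs_radius; assumption.
Qed.

Lemma Cmod_CPS_term (a : nat -> R) (z : C) (n : nat) : disk_coeffs a ->
  Cmod (RtoC (a n) * z ^ n)%C = a n * Cmod z ^ n.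
Proof.
intros [H0 _]; rewrite Cmod_mult, Cmod_R, Cmod_pow, Rabs_pos_eq; auto.
Qed.

Lemma CPS_cv (a : nat -> R) (z : C) : disk_coeffs a -> Cmod z < 1 ->
  ex_series (fun n => Cmod (RtoC (a n) * z ^ n)%C).
Proof.
intros Ha Hz; apply ex_series_ext with (fun n => a n * Cmod z ^ n).
- intros n; symmetry; now apply Cmod_CPS_term.
- apply disk_coeffs_ex_series; [assumption|]; split; [apply Cmod_ge_0|assumption].
Qed.

Lemma CPS_0 (a : nat -> R) : disk_coeffs a -> CPS a (RtoC 0) = RtoC (a O).
Proof.
intros Ha; unfold CPS; rewrite CSeries_incr_1.
- rewrite (CSeries_ext _ (fun _ => RtoC 0)).
  + replace (CSeries (fun _ => RtoC 0)) with (RtoC 0).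
    * simpl; ring.
    * unfold CSeries, RtoC; simpl.
      replace (Series (fun _ => 0)) with (Series (fun _ => 0 * 0))
        by (apply Series_ext; intros; ring).
      rewrite Series_scal_l; f_equal; ring.
  + intros n; simpl; ring.
- apply CPS_cv; [assumption|rewrite Cmod_0; lra].
Qed.

(* The Taylor remainder of [z ^ n] is a polynomial in [z] and [h] with
   nonnegative coefficients. *)
Lemma Cpow_remainder (z h : C) (n : nat) :
  Cmod ((z + h) ^ S n - z ^ S n - RtoC (INR (S n)) * z ^ n * h)%C
  <= (Cmod z + Cmod h) ^ S n - Cmod z ^ S n - INR (S n) * Cmod z ^ n * Cmod h.
Proof.
induction n as [|n IH].
- simpl; replace (_ - _ - _)%C with (RtoC 0) by ring; rewrite Cmod_0; lra.
- replace ((z + h) ^ S (S n) - z ^ S (S n) - RtoC (INR (S (S n))) * z ^ S n * h)%C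
    with ((z + h) * ((z + h) ^ S n - z ^ S n - RtoC (INR (S n)) * z ^ n * h)
          + RtoC (INR (S n)) * z ^ n * h * h)%C.
  2: { rewrite (S_INR (S n)), RtoC_plus; simpl Cpow; ring. }
  eapply Rle_trans; [apply Cmod_triangle|].
  rewrite !Cmod_mult, Cmod_pow, Cmod_R, (Rabs_pos_eq _ (pos_INR _)).
  replace ((Cmod z + Cmod h) ^ S (S n) - Cmod z ^ S (S n)
           - INR (S (S n)) * Cmod z ^ S n * Cmod h)
    with ((Cmod z + Cmod h)
          * ((Cmod z + Cmod h) ^ S n - Cmod z ^ S n - INR (S n) * Cmod z ^ n * Cmod h)
          + INR (S n) * Cmod z ^ n * Cmod h * Cmod h)
    by (rewrite (S_INR (S n)); simpl pow; ring).
  apply Rplus_le_compat_r, Rmult_le_compat; auto using Cmod_ge_0, Cmod_triangle.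
Qed.

Lemma CPS_remainder (a : nat -> R) (z h : C) : disk_coeffs a ->
  Cmod z + Cmod h < 1 ->
  Cmod (CPS a (z + h) - CPS a z - CPS (PS_derive a) z * h)%C
  <= PSeries a (Cmod z + Cmod h) - PSeries a (Cmod z)
     - PSeries (PS_derive a) (Cmod z) * Cmod h.
Proof.
intros Ha Hzh.
assert (Hz0 := Cmod_ge_0 z); assert (Hh0 := Cmod_ge_0 h).
assert (Hzh1 := Cmod_triangle z h).
assert (Ha' := disk_coeffs_derive a Ha).
assert (C1 : ex_series (fun n => Cmod (RtoC (a n) * (z + h) ^ n)%C))
  by (apply CPS_cv; [assumption|lra]).
assert (C2 : ex_series (fun n => Cmod (RtoC (a n) * z ^ n)%C))
  by (apply CPS_cv; [assumption|lra]).
assert (C3 : ex_series (fun n => Cmod (RtoC (PS_derive a n) * z ^ n)%C))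
  by (apply CPS_cv; [assumption|lra]).
assert (R1 := disk_coeffs_ex_series a (Cmod z + Cmod h) Ha ltac:(lra)).
assert (R2 := disk_coeffs_ex_series a (Cmod z) Ha ltac:(lra)).
assert (R3 := disk_coeffs_ex_series _ (Cmod z) Ha' ltac:(lra)).
unfold CPS, PSeries.
(* The constant terms cancel; after the shift, powers [S n] face [PS_derive a n], which is (n + 1)
   a_(n+1), and [Cpow_remainder] applies term by term. *)
rewrite (CSeries_incr_1 _ C1), (CSeries_incr_1 _ C2).
rewrite (Series_incr_1 _ R1), (Series_incr_1 _ R2).
apply ex_series_incr_1 in C1; apply ex_series_incr_1 in C2.
apply ex_series_incr_1 in R1; apply ex_series_incr_1 in R2.
simpl in C1, C2.
match goal with |- Cmod ?x <= ?y =>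
  replace x with (CSeries (fun n => RtoC (a (S n)) *
    ((z + h) ^ S n - z ^ S n - RtoC (INR (S n)) * z ^ n * h))%C);
  [replace y with (Series (fun n => a (S n) * ((Cmod z + Cmod h) ^ S n
     - Cmod z ^ S n - INR (S n) * Cmod z ^ n * Cmod h)))|] end.
- apply CSeries_Cmod_le.
  + intros n; rewrite Cmod_mult, Cmod_R, Rabs_pos_eq by apply Ha.
    apply Rmult_le_compat_l; [apply Ha|apply Cpow_remainder].
  + apply ex_series_ext with (fun n => a (S n) * (Cmod z + Cmod h) ^ S n
      - a (S n) * Cmod z ^ S n - PS_derive a n * Cmod z ^ n * Cmod h).
    * intros n; unfold PS_derive.
      match goal with |- ?x = ?y => change (x = y :> R) end; ring.
    * apply (@ex_series_minus R_AbsRing R_NormedModule);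
        [now apply (@ex_series_minus R_AbsRing R_NormedModule)|].
      now apply ex_series_scal_r.
- rewrite (Series_ext _ (fun n => a (S n) * (Cmod z + Cmod h) ^ S n
      - a (S n) * Cmod z ^ S n - PS_derive a n * Cmod z ^ n * Cmod h)).
  + rewrite Series_minus;
      [|now apply (@ex_series_minus R_AbsRing R_NormedModule)|now apply ex_series_scal_r].
    rewrite Series_minus by assumption; rewrite Series_scal_r; simpl; ring.
  + intros n; unfold PS_derive; ring.
- rewrite (CSeries_ext _ (fun n => (RtoC (a (S n)) * (z + h) ^ S n
      + (- RtoC 1) * (RtoC (a (S n)) * z ^ S n))
      + (- h) * (RtoC (PS_derive a n) * z ^ n))%C).
  + rewrite CSeries_plus, CSeries_plus, !CSeries_scal; auto using ex_series_Cmod_scal,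
      ex_series_Cmod_plus.
    simpl; ring.
  + intros n; unfold PS_derive; rewrite RtoC_mult; ring.
Qed.

(** The bound of [CPS_remainder] is the first-order remainder of the real series at [Cmod z] with
    increment [Cmod h], and real power series are differentiable inside their interval of
    convergence. *)
Lemma is_C_derive_CPS (a : nat -> R) (z : C) : disk_coeffs a -> Cmod z < 1 ->
  is_derive (CPS a) z (CPS (PS_derive a) z).
Proof.
intros Ha Hz; apply is_C_derive_iff; intros eps Heps.
assert (Hz0 := Cmod_ge_0 z).
assert (Hd := is_derive_PSeries a (Cmod z)
                (disk_coeffs_radius a (Cmod z) Ha ltac:(lra))).
apply is_derive_Reals in Hd; destruct (Hd eps Heps) as [d Hdd].
exists (Rmin d (1 - Cmod z)); split; [apply Rmin_glb_lt; [apply cond_pos|lra]|].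
intros h Hh.
assert (Hh1 := Rlt_le_trans _ _ _ Hh (Rmin_l _ _)).
assert (Hh2 := Rlt_le_trans _ _ _ Hh (Rmin_r _ _)).
eapply Rle_trans; [apply CPS_remainder; [assumption|lra]|].
destruct (Cmod_ge_0 h) as [H0|H0].
- assert (H := Hdd (Cmod h) ltac:(lra)); rewrite Rabs_pos_eq in H by lra.
  specialize (H Hh1); apply Rabs_def2 in H.
  set (P := PSeries a (Cmod z + Cmod h)) in *.
  replace (P - _ - _) with
    (((P - PSeries a (Cmod z)) / Cmod h - PSeries (PS_derive a) (Cmod z)) * Cmod h)
    by (field; lra).
  apply Rmult_le_compat_r; lra.
- rewrite <- H0, Rplus_0_r; lra.
Qed.

(** * Compactness and the maximum principle *)

Lemma Cmod_le_sum (z : C) : Cmod z <= Rabs (Re z) + Rabs (Im z).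
Proof.
assert (E : z = (RtoC (Re z) + Ci * RtoC (Im z))%C)
  by (destruct z; unfold RtoC, Ci, Cmult, Cplus; simpl; f_equal; ring).
rewrite E at 1.
eapply Rle_trans; [apply Cmod_triangle|].
rewrite Cmod_mult, Cmod_Ci, !Cmod_R, Rmult_1_l; apply Rle_refl.
Qed.

(** Heine-Borel for a property [Q d] that persists when [d] shrinks. Local scales are also asked for
    at points outside [P], which is how closedness of [P] comes in. *)
Lemma compact_uniform (P : C -> Prop) (Q : R -> C -> Prop) (M : R) :
  (forall z, P z -> Cmod z <= M) ->
  (forall d e z, d <= e -> Q e z -> Q d z) ->
  (forall u, exists d, 0 < d /\
     forall h : C, Cmod h < d -> P (u + h)%C -> Q d (u + h)%C) ->
  exists d, 0 < d /\ forall z, P z -> Q d z.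
Proof.
intros HM HQ H.
(* The compactness theorem wants a gauge given as a function, hence the choice of a scale at each
   point; it is halved below because [Cmod] is estimated by the sum of two coordinates. *)
set (D := fun u => constructive_indefinite_description _ (H u)).
assert (HD : forall x y : R, 0 < proj1_sig (D (x, y)) / 2).
{ intros x y; destruct (D (x, y)) as [d [Hd ?]]; simpl; lra. }
destruct (compactness_value_2d (- M) M (- M) M
            (fun x y => mkposreal _ (HD x y))) as [d Hd].
exists d; split; [apply cond_pos|]; intros z Hz; apply NNPP; intros Hn.
assert (Hzm := HM z Hz).
assert (Hre := re_le_Cmod z); assert (Him := im_le_Cmod z).
apply (Hd (Re z) (Im z)); [apply Rabs_le_between; lra|apply Rabs_le_between; lra|].
intros [x [y [_ [_ [Hx [Hy Hxy]]]]]]; apply Hn.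
simpl in Hx, Hy, Hxy.
destruct (D (x, y)) as [e [He H1]]; simpl in Hx, Hy, Hxy.
apply HQ with e; [lra|].
replace z with ((x, y) + (z - (x, y)))%C by ring.
apply H1.
- eapply Rle_lt_trans; [apply Cmod_le_sum|].
  unfold Cminus, Cplus, Copp; unfold Re, Im, Rminus in *; simpl; lra.
- now replace ((x, y) + (z - (x, y)))%C with z by ring.
Qed.

Definition rcont (g : C -> R) (z : C) : Prop :=
  forall eps, 0 < eps -> exists delta, 0 < delta /\
    forall h : C, Cmod h < delta -> Rabs (g (z + h)%C - g z) < eps.

Lemma compact_min (P : C -> Prop) (g : C -> R) (M : R) :
  (forall z, P z -> Cmod z <= M) ->
  (forall z, ~ P z -> exists d, 0 < d /\ forall h : C, Cmod h < d -> ~ P (z + h)%C) ->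
  (forall z, P z -> rcont g z) ->
  (exists z, P z) -> exists z0, P z0 /\ forall z, P z -> g z0 <= g z.
Proof.
intros HM HP Hg [z1 Hz1].
(* First pass: [g] is bounded below. The bound - 1 / d weakens as [d] decreases to 0; the
   alternative [d <= 0] extends the monotonicity to nonpositive scales. *)
destruct (compact_uniform P (fun d z => - / d <= g z \/ d <= 0) M HM) as [d [Hd0 Hd]].
{ intros d e z Hde [H|H]; [|right; lra].
  destruct (Rle_lt_dec d 0) as [Hd|Hd]; [now right|left].
  assert (/ e <= / d) by (apply Rinv_le_contravar; lra); lra. }
{ intros u; destruct (classic (P u)) as [Hu|Hu].
  - destruct (Hg u Hu 1 Rlt_0_1) as [d [Hd0 Hd]].
    assert (Hp : 0 < / (Rabs (g u) + 1))
      by (apply Rinv_0_lt_compat; generalize (Rabs_pos (g u)); lra).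
    exists (Rmin d (/ (Rabs (g u) + 1))); split; [now apply Rmin_glb_lt|].
    intros h Hh _; left.
    specialize (Hd h (Rlt_le_trans _ _ _ Hh (Rmin_l _ _))); apply Rabs_def2 in Hd.
    assert (H1 : / / (Rabs (g u) + 1) <= / Rmin d (/ (Rabs (g u) + 1)))
      by (apply Rinv_le_contravar; [now apply Rmin_glb_lt|apply Rmin_r]).
    rewrite Rinv_inv in H1.
    generalize (Rle_abs (- g u)); rewrite Rabs_Ropp; lra.
  - destruct (HP u Hu) as [d [Hd0 Hd]]; exists d; split; [assumption|].
    intros h Hh Hc; now destruct (Hd h Hh). }
destruct (completeness (fun y => exists z, P z /\ y = - g z)) as [m [Hm1 Hm2]].
{ exists (/ d); intros y [z [Hz ->]]; destruct (Hd z Hz); lra. }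
{ exists (- g z1); now exists z1. }
apply NNPP; intros Hno.
assert (Hlt : forall z, P z -> - g z < m).
{ intros z Hz; destruct (Rle_lt_or_eq_dec (- g z) m) as [H|H]; [|assumption|].
  - apply Hm1; now exists z.
  - exfalso; apply Hno; exists z; split; [assumption|]; intros y Hy.
    assert (- g y <= m) by (apply Hm1; now exists y); lra. }
(* Second pass: were the infimum - m not attained, [g] would exceed it by a fixed margin. *)
destruct (compact_uniform P (fun d z => - g z <= m - d) M HM) as [e [He0 He]].
{ intros; lra. }
{ intros u; destruct (classic (P u)) as [Hu|Hu].
  - specialize (Hlt u Hu).
    destruct (Hg u Hu ((m + g u) / 2)) as [d' [Hd0' Hd']]; [lra|].
    exists (Rmin d' ((m + g u) / 2)); split; [apply Rmin_glb_lt; lra|].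
    intros h Hh _.
    specialize (Hd' h (Rlt_le_trans _ _ _ Hh (Rmin_l _ _))); apply Rabs_def2 in Hd'.
    generalize (Rmin_r d' ((m + g u) / 2)); lra.
  - destruct (HP u Hu) as [d' [Hd0' Hd']]; exists d'; split; [assumption|].
    intros h Hh Hc; now destruct (Hd' h Hh). }
assert (m <= m - e); [|lra].
apply Hm2; intros y [z [Hz ->]]; auto.
Qed.

Definition Cdot (x y : C) : R := Re x * Re y + Im x * Im y.

Lemma Cdot_Cmod (z : C) : Cdot z z = Cmod z ^ 2.
Proof. rewrite Cmod2_alt; unfold Cdot; ring. Qed.

Lemma rcont_Cmod2 (v : C -> C) (z : C) : ccont v z -> rcont (fun y => Cmod (v y) ^ 2) z.
Proof.
intros H eps Heps.
assert (Hm := Cmod_ge_0 (v z)).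
assert (Hp : 0 < eps / (2 * Cmod (v z) + 1)) by (apply Rdiv_lt_0_compat; lra).
destruct (H (Rmin 1 (eps / (2 * Cmod (v z) + 1)))) as [d [Hd0 Hd]];
  [apply Rmin_glb_lt; lra|].
exists d; split; [assumption|]; intros h Hh; specialize (Hd h Hh).
assert (H1 := Rlt_le_trans _ _ _ Hd (Rmin_l _ _)).
assert (H2 := Rlt_le_trans _ _ _ Hd (Rmin_r _ _)).
apply Rlt_div_r in H2; [|lra].
assert (H3 := Cmod_minus_ge (v (z + h)%C) (v z)).
assert (H4 := Cmod_minus_ge (v z) (v (z + h)%C)).
rewrite <- (Cmod_opp (v z - _)) in H4.
replace (- (v z - v (z + h)))%C with (v (z + h) - v z)%C in H4 by ring.
set (k := Cmod (v (z + h) - v z)%C) in *.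
assert (0 <= k) by apply Cmod_ge_0.
assert (H5 := Cmod_ge_0 (v (z + h)%C)).
apply Rabs_def1; nra.
Qed.

Lemma rcont_Cmod (z : C) : rcont Cmod z.
Proof.
intros eps Heps; exists eps; split; [assumption|]; intros h Hh.
assert (H3 := Cmod_minus_ge (z + h)%C z).
assert (H4 := Cmod_triangle z h).
replace (z + h - z)%C with h in H3 by ring.
assert (H5 := Cmod_minus_ge z (z + h)%C).
replace (z - (z + h))%C with (- h)%C in H5 by ring; rewrite Cmod_opp in H5.
apply Rabs_def1; lra.
Qed.

Lemma rcont_lin (f g : C -> R) (k : R) (z : C) : rcont f z -> rcont g z ->
  rcont (fun y => f y + k * g y) z.
Proof.
intros Hf Hg eps Heps.
assert (Hk := Rabs_pos k).
destruct (Hf (eps / 2)) as [d1 [Hd1 H1]]; [lra|].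
destruct (Hg (eps / 2 / (Rabs k + 1))) as [d2 [Hd2 H2]];
  [apply Rdiv_lt_0_compat; lra|].
exists (Rmin d1 d2); split; [now apply Rmin_glb_lt|]; intros h Hh.
specialize (H1 h (Rlt_le_trans _ _ _ Hh (Rmin_l _ _))).
specialize (H2 h (Rlt_le_trans _ _ _ Hh (Rmin_r _ _))).
apply Rlt_div_r in H2; [|lra].
replace (f (z + h)%C + k * g (z + h)%C - (f z + k * g z))
  with ((f (z + h)%C - f z) + k * (g (z + h)%C - g z)) by ring.
eapply Rle_lt_trans; [apply Rabs_triang|]; rewrite Rabs_mult.
assert (H3 := Rabs_pos (g (z + h)%C - g z)); nra.
Qed.

Lemma closed_disk_closed (r : R) (z : C) : ~ Cmod z <= r ->
  exists d, 0 < d /\ forall h : C, Cmod h < d -> ~ Cmod (z + h)%C <= r.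
Proof.
intros Hz; destruct (rcont_Cmod z (Cmod z - r)) as [d [Hd H]]; [lra|].
exists d; split; [assumption|]; intros h Hh; specialize (H h Hh).
apply Rabs_def2 in H; lra.
Qed.

(** * Differentiation along real paths, and maxima *)

Lemma is_R_derive_iff (f : R -> R) (x l : R) :
  is_derive f x l <->
  forall eps, 0 < eps -> exists delta, 0 < delta /\ forall h, Rabs h < delta ->
    Rabs (f (x + h) - f x - l * h) <= eps * Rabs h.
Proof.
rewrite is_derive_Reals; split; intros H eps Heps.
- destruct (H eps Heps) as [d Hd]; exists d; split; [apply cond_pos|]; intros h Hh.
  destruct (Req_dec h 0) as [->|H0].
  + rewrite Rplus_0_r, Rabs_R0; replace (_ - _ - _) with 0 by ring.
    rewrite Rabs_R0; lra.
  + specialize (Hd h H0 Hh).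
    replace (f (x + h) - f x - l * h) with (((f (x + h) - f x) / h - l) * h)
      by (field; assumption).
    rewrite Rabs_mult; apply Rmult_le_compat_r; [apply Rabs_pos|lra].
- destruct (H (eps / 2)) as [d [Hd0 Hd]]; [lra|].
  exists (mkposreal d Hd0); intros h H0 Hh; specialize (Hd h Hh).
  replace ((f (x + h) - f x) / h - l) with ((f (x + h) - f x - l * h) / h)
    by (field; assumption).
  unfold Rdiv at 1; rewrite Rabs_mult, Rabs_inv.
  assert (Hp := Rabs_pos_lt h H0).
  apply Rle_lt_trans with (eps / 2); [|lra].
  now apply Rle_div_l.
Qed.

Definition is_path_derive (p : R -> C) (t : R) (l : C) : Prop :=
  is_derive (fun x => Re (p x)) t (Re l) /\ is_derive (fun x => Im (p x)) t (Im l).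

Lemma is_path_derive_iff (p : R -> C) (t : R) (l : C) :
  is_path_derive p t l <->
  forall eps, 0 < eps -> exists delta, 0 < delta /\ forall h, Rabs h < delta ->
    Cmod (p (t + h)%R - p t - l * RtoC h)%C <= eps * Rabs h.
Proof.
unfold is_path_derive; rewrite !is_R_derive_iff.
assert (E1 : forall h, Re (p (t + h)%R - p t - l * RtoC h)%C
  = Re (p (t + h)%R) - Re (p t) - Re l * h)
  by (intros; unfold Re, Cminus, Cplus, Copp, Cmult, RtoC; simpl; ring).
assert (E2 : forall h, Im (p (t + h)%R - p t - l * RtoC h)%C
  = Im (p (t + h)%R) - Im (p t) - Im l * h)
  by (intros; unfold Im, Cminus, Cplus, Copp, Cmult, RtoC; simpl; ring).
split.
- intros [H1 H2] eps Heps.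
  destruct (H1 (eps / 2)) as [d1 [Hd1 K1]]; [lra|].
  destruct (H2 (eps / 2)) as [d2 [Hd2 K2]]; [lra|].
  exists (Rmin d1 d2); split; [now apply Rmin_glb_lt|]; intros h Hh.
  specialize (K1 h (Rlt_le_trans _ _ _ Hh (Rmin_l _ _))).
  specialize (K2 h (Rlt_le_trans _ _ _ Hh (Rmin_r _ _))).
  eapply Rle_trans; [apply Cmod_le_sum|]; rewrite E1, E2; lra.
- intros H; split; intros eps Heps; destruct (H eps Heps) as [d [Hd K]];
    exists d; (split; [assumption|]); intros h Hh; specialize (K h Hh).
  + rewrite <- E1; eapply Rle_trans; [apply re_le_Cmod|assumption].
  + rewrite <- E2; eapply Rle_trans; [apply im_le_Cmod|assumption].
Qed.

Lemma is_path_derive_comp (f : C -> C) (p : R -> C) (t : R) (l a : C) :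
  is_derive f (p t) l -> is_path_derive p t a ->
  is_path_derive (fun x => f (p x)) t (l * a)%C.
Proof.
rewrite is_C_derive_iff, !is_path_derive_iff; intros Hf Hp eps Heps.
assert (Hl := Cmod_ge_0 l); assert (Ha := Cmod_ge_0 a).
(* The increment of [p] is at most (|a| + 1) |h|, so the error of [f] costs eps / 2; the error of
   [p], multiplied by [l], costs the other half. *)
destruct (Hf (eps / 2 / (Cmod a + 1))) as [d1 [Hd1 H1]]; [apply Rdiv_lt_0_compat; lra|].
destruct (Hp (Rmin 1 (eps / 2 / (Cmod l + 1)))) as [d2 [Hd2 H2]].
{ apply Rmin_glb_lt; [lra|]; apply Rdiv_lt_0_compat; lra. }
exists (Rmin d2 (d1 / (Cmod a + 1))); split.
{ apply Rmin_glb_lt; [assumption|]; apply Rdiv_lt_0_compat; lra. }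
intros h Hh.
specialize (H2 h (Rlt_le_trans _ _ _ Hh (Rmin_l _ _))).
assert (Hh1 := Rlt_le_trans _ _ _ Hh (Rmin_r _ _)).
apply Rlt_div_r in Hh1; [|lra].
assert (Hh0 := Rabs_pos h).
assert (H3 : Cmod (p (t + h)%R - p t - a * RtoC h)%C <= 1 * Rabs h).
{ eapply Rle_trans; [exact H2|]; apply Rmult_le_compat_r; [lra|apply Rmin_l]. }
assert (H4 : Cmod (p (t + h)%R - p t - a * RtoC h)%C
             <= eps / 2 / (Cmod l + 1) * Rabs h).
{ eapply Rle_trans; [exact H2|]; apply Rmult_le_compat_r; [lra|apply Rmin_r]. }
set (k := (p (t + h)%R - p t)%C) in *.
assert (Hk : Cmod k <= (Cmod a + 1) * Rabs h).
{ replace k with ((k - a * RtoC h) + a * RtoC h)%C by ring.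
  eapply Rle_trans; [apply Cmod_triangle|]; rewrite Cmod_mult, Cmod_R; lra. }
specialize (H1 k ltac:(lra)).
replace (p t + k)%C with (p (t + h)%R) in H1 by (unfold k; ring).
replace (f (p (t + h)%R) - f (p t) - l * a * RtoC h)%C
  with ((f (p (t + h)%R) - f (p t) - l * k) + l * (k - a * RtoC h))%C by ring.
eapply Rle_trans; [apply Cmod_triangle|]; rewrite (Cmod_mult l).
assert (H5 : Cmod (f (p (t + h)%R) - f (p t) - l * k)%C <= eps / 2 * Rabs h).
{ eapply Rle_trans; [exact H1|].
  replace (eps / 2 * Rabs h)
    with (eps / 2 / (Cmod a + 1) * ((Cmod a + 1) * Rabs h)) by (field; lra).
  apply Rmult_le_compat_l; [|assumption].
  apply Rlt_le, Rdiv_lt_0_compat; lra. }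
assert (H6 : (Cmod l + 1) * Cmod (k - a * RtoC h)%C <= eps / 2 * Rabs h).
{ replace (eps / 2 * Rabs h)
    with ((Cmod l + 1) * (eps / 2 / (Cmod l + 1) * Rabs h)) by (field; lra).
  apply Rmult_le_compat_l; lra. }
assert (H7 := Cmod_ge_0 (k - a * RtoC h)%C); nra.
Qed.

Lemma is_derive_Cdot (p q : R -> C) (t : R) (a b : C) :
  is_path_derive p t a -> is_path_derive q t b ->
  is_derive (fun x => Cdot (p x) (q x)) t (Cdot a (q t) + Cdot (p t) b).
Proof.
intros [P1 P2] [Q1 Q2]; unfold Cdot.
replace (Re a * Re (q t) + Im a * Im (q t) + (Re (p t) * Re b + Im (p t) * Im b))
  with ((Re a * Re (q t) + Re (p t) * Re b) + (Im a * Im (q t) + Im (p t) * Im b))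
  by ring.
apply (is_derive_plus (fun x => Re (p x) * Re (q x)) (fun x => Im (p x) * Im (q x)));
  apply (is_derive_mult (K := R_AbsRing)); auto using Rmult_comm.
Qed.

Lemma derive_right_max (g : R -> R) (l d : R) : is_derive g 0 l -> 0 < d ->
  (forall t, 0 < t < d -> g t <= g 0) -> l <= 0.
Proof.
intros Hg Hd H; apply Rnot_lt_le; intros Hl.
rewrite is_R_derive_iff in Hg; destruct (Hg (l / 2)) as [e [He K]]; [lra|].
set (t := Rmin d e / 2).
assert (Ht : 0 < t < Rmin d e)
  by (assert (0 < Rmin d e) by (now apply Rmin_glb_lt); unfold t; lra).
specialize (K t); rewrite (Rabs_pos_eq t) in K by lra.
specialize (K (Rlt_le_trans _ _ _ (proj2 Ht) (Rmin_r _ _))).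
specialize (H t (conj (proj1 Ht) (Rlt_le_trans _ _ _ (proj2 Ht) (Rmin_l _ _)))).
rewrite Rplus_0_l in K; apply Rabs_le_between in K; nra.
Qed.

Lemma derive_left_max (g : R -> R) (l d : R) : is_derive g 0 l -> 0 < d ->
  (forall t, - d < t < 0 -> g t <= g 0) -> 0 <= l.
Proof.
intros Hg Hd H.
enough (- l <= 0) by lra.
apply derive_right_max with (g := fun t => g (- t)) (d := d); [|assumption|].
- replace (- l) with ((-1) * l) by ring.
  apply (is_derive_comp g (fun t => - t)); [now rewrite Ropp_0|].
  auto_derive; [trivial|ring].
- intros t Ht; rewrite Ropp_0; apply H; lra.
Qed.

(** The first derivative vanishes at 0; a positive second one would make [g1] positive just to the
    right, and the mean value theorem would produce a larger value of [g]. *)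
Lemma second_derive_max (g g1 : R -> R) (l d : R) : 0 < d ->
  (forall t, Rabs t < d -> is_derive g t (g1 t)) -> is_derive g1 0 l ->
  (forall t, Rabs t < d -> g t <= g 0) -> l <= 0.
Proof.
intros Hd Hg Hg1 Hmax.
assert (H0 : g1 0 = 0).
{ assert (G0 := Hg 0); rewrite Rabs_R0 in G0; specialize (G0 Hd).
  apply Rle_antisym.
  - apply derive_right_max with g d; auto; intros t Ht; apply Hmax.
    rewrite Rabs_pos_eq; lra.
  - apply derive_left_max with g d; auto; intros t Ht; apply Hmax.
    rewrite Rabs_left; lra. }
apply Rnot_lt_le; intros Hl.
rewrite is_R_derive_iff in Hg1; destruct (Hg1 (l / 2)) as [e [He K]]; [lra|].
set (t := Rmin d e / 2).
assert (Hm : 0 < Rmin d e) by (now apply Rmin_glb_lt).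
assert (Hmd := Rmin_l d e); assert (Hme := Rmin_r d e).
destruct (MVT_cor2 g g1 0 t) as [c [Hc1 Hc2]].
- unfold t; lra.
- intros c Hc; apply is_derive_Reals, Hg; rewrite Rabs_pos_eq; unfold t in Hc; lra.
- assert (Hgt := Hmax t); rewrite Rabs_pos_eq in Hgt by (unfold t; lra).
  specialize (Hgt ltac:(unfold t; lra)).
  specialize (K c); rewrite (Rabs_pos_eq c) in K by lra.
  specialize (K ltac:(unfold t in Hc2; lra)).
  rewrite Rplus_0_l, H0 in K; apply Rabs_le_between in K.
  assert (0 < g1 c) by nra; nra.
Qed.

Lemma is_path_derive_line (z u : C) (t : R) :
  is_path_derive (fun x => z + RtoC x * u)%C t u.
Proof. split; simpl; auto_derive; trivial; unfold Re, Im; ring. Qed.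

Lemma is_path_derive_scal (p : R -> C) (t : R) (a k : C) : is_path_derive p t a ->
  is_path_derive (fun x => p x * k)%C t (a * k)%C.
Proof.
intros H; rewrite (Cmult_comm a).
apply (is_path_derive_comp (fun y => y * k)%C p); [|assumption].
assert (D : is_derive (fun y => y * k)%C (p t) (1 * k + p t * 0)%C).
{ apply (is_C_derive_mult (fun y => y) (fun _ => k)); [apply is_C_derive_id|].
  apply is_C_derive_AbsRing, @is_derive_const. }
now replace (1 * k + p t * 0)%C with k in D by ring.
Qed.

(* [Cmod v ^ 2 + eps * Cmod z ^ 2] has Laplacian at least [4 * eps], hence no
   interior maximum. *)
Lemma maximum_modulus (v v1 v2 : C -> C) (r M : R) :
  (forall z, Cmod z < r -> is_derive v z (v1 z)) ->
  (forall z, Cmod z < r -> is_derive v1 z (v2 z)) ->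
  (forall z, Cmod z <= r -> ccont v z) ->
  (forall z, Cmod z = r -> Cmod (v z) <= M) ->
  forall z, Cmod z <= r -> Cmod (v z) <= M.
Proof.
intros Hv Hv1 Hc HM z Hz.
assert (Hr : 0 <= r) by (generalize (Cmod_ge_0 z); lra).
assert (HM0 : 0 <= M).
{ apply Rle_trans with (Cmod (v (RtoC r))); [apply Cmod_ge_0|].
  apply HM; rewrite Cmod_R; now apply Rabs_pos_eq. }
(* An excess of |v z|^2 over M^2 is refuted by an [eps] so small that eps r^2 is less than half of
   it. *)
enough (H : forall eps, 0 < eps -> Cmod (v z) ^ 2 <= M ^ 2 + eps * r ^ 2).
{ apply Rnot_lt_le; intros Hlt.
  assert (Hs : 0 < Cmod (v z) ^ 2 - M ^ 2) by nra.
  specialize (H ((Cmod (v z) ^ 2 - M ^ 2) / (2 * (r ^ 2 + 1)))).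
  assert (H2 : 0 <= r ^ 2) by nra.
  assert (Hpos : 0 < (Cmod (v z) ^ 2 - M ^ 2) / (2 * (r ^ 2 + 1)))
    by (apply Rdiv_lt_0_compat; lra).
  specialize (H Hpos).
  set (e := (Cmod (v z) ^ 2 - M ^ 2) / (2 * (r ^ 2 + 1))) in *.
  assert (He : e * (2 * (r ^ 2 + 1)) = Cmod (v z) ^ 2 - M ^ 2)
    by (unfold e; field; lra).
  nra. }
intros eps Heps.
destruct (compact_min (fun y => Cmod y <= r)
  (fun y => 0 + (-1) * (Cmod (v y) ^ 2 + eps * Cmod y ^ 2)) r) as [z0 [Hz0 Hmax]].
- auto.
- apply closed_disk_closed.
- intros y Hy; apply rcont_lin.
  + intros e He; exists 1; split; [lra|]; intros; rewrite Rminus_diag, Rabs_R0; lra.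
  + apply rcont_lin; apply rcont_Cmod2; [auto|].
    apply (is_C_derive_ccont (fun x => x) y 1), is_C_derive_id.
- now exists z.
- assert (Hmax' : forall y, Cmod y <= r ->
    Cmod (v y) ^ 2 + eps * Cmod y ^ 2 <= Cmod (v z0) ^ 2 + eps * Cmod z0 ^ 2).
  { intros y Hy; specialize (Hmax y Hy); simpl in Hmax; lra. }
  clear Hmax.
  destruct (Rle_lt_or_eq_dec _ _ Hz0) as [Hlt|Heq].
  2: { specialize (Hmax' z Hz); specialize (HM z0 Heq); rewrite Heq in Hmax'.
       assert (Hvz := Cmod_ge_0 (v z0)).
       assert (0 <= eps * Cmod z ^ 2) by (apply Rmult_le_pos; [lra|apply pow2_ge_0]).
       assert (Cmod (v z0) ^ 2 <= M ^ 2) by (apply pow_incr; lra).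
       lra. }
  exfalso.
  assert (Hdir : forall u : C, Cmod u = 1 ->
    2 * (Cdot (v1 z0 * u) (v1 z0 * u) + Cdot (v z0) (v2 z0 * u * u)) + 2 * eps <= 0).
  { intros u Hu.
    assert (Hin : forall t, Rabs t < r - Cmod z0 -> Cmod (z0 + RtoC t * u)%C < r).
    { intros t Ht; eapply Rle_lt_trans; [apply Cmod_triangle|].
      rewrite Cmod_mult, Hu, Cmod_R; lra. }
    pose (L := fun t : R => (z0 + RtoC t * u)%C).
    assert (HL0 : L 0 = z0) by (unfold L; ring).
    assert (D1 : forall t, Rabs t < r - Cmod z0 ->
      is_path_derive (fun x => v (L x)) t (v1 (L t) * u)%C).
    { intros t Ht; apply is_path_derive_comp; [apply Hv, Hin, Ht|].
      apply is_path_derive_line. }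
    assert (D2 : is_path_derive (fun x => v1 (L x) * u)%C 0 (v2 z0 * u * u)%C).
    { apply is_path_derive_scal, is_path_derive_comp; [rewrite HL0; apply Hv1, Hlt|].
      apply is_path_derive_line. }
    apply second_derive_max with (d := r - Cmod z0)
      (g := fun t => Cdot (v (L t)) (v (L t)) + eps * Cdot (L t) (L t))
      (g1 := fun t => 2 * Cdot (v (L t)) (v1 (L t) * u)%C + eps * (2 * Cdot (L t) u)).
    - lra.
    - intros t Ht; specialize (D1 t Ht).
      apply (is_derive_plus (fun x => Cdot (v (L x)) (v (L x)))
               (fun x => eps * Cdot (L x) (L x))).
      + replace (2 * _) with (Cdot (v1 (L t) * u)%C (v (L t))
                              + Cdot (v (L t)) (v1 (L t) * u)%C)
          by (unfold Cdot; ring).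
        now apply is_derive_Cdot.
      + apply is_derive_scal.
        replace (2 * _) with (Cdot u (L t) + Cdot (L t) u) by (unfold Cdot; ring).
        apply is_derive_Cdot; apply is_path_derive_line.
    - replace (2 * eps) with (eps * (2 * Cdot u u)) by (rewrite Cdot_Cmod, Hu; ring).
      apply (is_derive_plus (fun t => 2 * Cdot (v (L t)) (v1 (L t) * u)%C)
               (fun t => eps * (2 * Cdot (L t) u))).
      + apply is_derive_scal.
        rewrite <- HL0 at 1 2 3.
        apply (is_derive_Cdot (fun x => v (L x)) (fun x => v1 (L x) * u)%C);
          [|assumption].
        apply D1; rewrite Rabs_R0; lra.
      + apply is_derive_scal, is_derive_scal.
        replace (Cdot u u) with (Cdot u u + Cdot (L 0) 0)%R
          by (unfold Cdot; simpl; ring).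
        apply (is_derive_Cdot L (fun _ => u)); [apply is_path_derive_line|].
        split; apply @is_derive_const.
    - intros t Ht; rewrite HL0, !Cdot_Cmod; apply Hmax', Rlt_le, Hin, Ht. }
  (* Adding the directions 1 and i cancels the terms with [v2], as 1 + i^2 = 0, and leaves 4 |v1|^2
     + 4 eps <= 0. *)
  assert (E1 := Hdir 1%C Cmod_1); assert (E2 := Hdir Ci Cmod_Ci).
  unfold Cdot, Re, Im, Ci, RtoC, Cmult in E1, E2; simpl in E1, E2; nra.
Qed.

(** * First contact with a half-plane *)

(** The points with [D <= 0] in the closed disk through a bad point form a compact set, on which the
    modulus attains its minimum. *)
Lemma first_contact (D : C -> R) :
  (forall z, Cmod z < 1 -> rcont D z) -> 0 < D (RtoC 0) ->
  (exists z, Cmod z < 1 /\ D z <= 0) ->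
  exists z0, 0 < Cmod z0 < 1 /\ D z0 = 0 /\
    (forall z, Cmod z < Cmod z0 -> 0 < D z) /\
    (forall z, Cmod z <= Cmod z0 -> 0 <= D z).
Proof.
intros Hc H0 [z1 [Hz1 HD1]].
destruct (compact_min (fun z => Cmod z <= Cmod z1 /\ D z <= 0) Cmod (Cmod z1))
  as [z0 [[Hz0 HD0] Hmin]].
- tauto.
- intros z Hz; destruct (Rle_lt_dec (Cmod z) (Cmod z1)) as [Hle|Hlt].
  + assert (HD : 0 < D z) by (apply Rnot_le_lt; tauto).
    destruct (Hc z ltac:(lra) (D z) HD) as [d [Hd K]]; exists d; split; [assumption|].
    intros h Hh [_ Hn]; specialize (K h Hh); apply Rabs_def2 in K; lra.
  + destruct (closed_disk_closed (Cmod z1) z) as [d [Hd K]]; [lra|].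
    exists d; split; [assumption|]; intros h Hh [Hn _]; now apply (K h Hh).
- intros; apply rcont_Cmod.
- exists z1; lra.
- assert (Hpos : forall z, Cmod z < Cmod z0 -> 0 < D z).
  { intros z Hz; apply Rnot_le_lt; intros Hn.
    assert (Cmod z0 <= Cmod z) by (apply Hmin; lra); lra. }
  assert (Hnz : 0 < Cmod z0).
  { apply Cmod_gt_0; intros ->; lra. }
  assert (Hnn : forall z, Cmod z <= Cmod z0 -> 0 <= D z).
  { intros z [Hz|Hz]; [now apply Rlt_le, Hpos|].
    apply Rnot_lt_le; intros Hn.
    destruct (Hc z ltac:(lra) (- D z)) as [d [Hd K]]; [lra|].
    (* On the contact circle [D] is a limit of positive values at the points (1 - e) z; d / 2 is
       small enough since |z| < 1. *)
    set (e := Rmin 1 (d / 2)).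
    assert (He : 0 < e <= 1) by (split; [apply Rmin_glb_lt; lra|apply Rmin_l]).
    assert (He2 : e <= d / 2) by apply Rmin_r.
    specialize (K (RtoC (- e) * z)%C).
    rewrite Cmod_mult, Cmod_R, Rabs_left, Ropp_involutive in K by lra.
    specialize (K ltac:(nra)).
    replace (z + RtoC (- e) * z)%C with (RtoC (1 - e) * z)%C in K
      by (rewrite RtoC_minus, RtoC_opp; ring).
    assert (0 < D (RtoC (1 - e) * z)%C).
    { apply Hpos; rewrite Cmod_mult, Cmod_R, Rabs_pos_eq by lra; nra. }
    apply Rabs_def2 in K; lra. }
  exists z0; repeat split; auto; try lra.
  apply Rle_antisym; [assumption|apply Hnn, Rle_refl].
Qed.

Lemma exp_le_1 (x : R) : x <= 0 -> exp x <= 1.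
Proof.
rewrite <- exp_0; intros [H| ->]; [now apply Rlt_le, exp_increasing|apply Rle_refl].
Qed.

(** The exponential exp (mu t) in coordinates. Multiplied by a nonzero point it runs along a ray for
    mu = 1, a circle for mu = i, a logarithmic spiral in general. *)
Definition cexp_path (mu : C) (t : R) : C :=
  (exp (Re mu * t) * cos (Im mu * t), exp (Re mu * t) * sin (Im mu * t)).

Lemma is_path_derive_cexp_path (mu : C) (t : R) :
  is_path_derive (cexp_path mu) t (mu * cexp_path mu t)%C.
Proof.
unfold cexp_path; split; simpl; auto_derive; trivial; unfold Re, Im; simpl; ring.
Qed.

Lemma Cmod_cexp_path (mu : C) (t : R) : Cmod (cexp_path mu t) = exp (Re mu * t).
Proof.
assert (He := exp_pos (Re mu * t)).
apply Rsqr_inj; [apply Cmod_ge_0|lra|].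
rewrite !Rsqr_pow2, Cmod2_alt; unfold cexp_path; simpl.
assert (H := sin2_cos2 (Im mu * t)); unfold Rsqr in H.
set (c := cos _) in *; set (e := exp _) in *; set (d := sin _) in *.
replace (_ + _) with (e * e * (d * d + c * c)) by ring; rewrite H; ring.
Qed.

Lemma cexp_path_0 (mu : C) : cexp_path mu 0 = 1%C.
Proof.
unfold cexp_path; rewrite !Rmult_0_r, exp_0, cos_0, sin_0.
unfold RtoC; f_equal; ring.
Qed.

Lemma is_path_derive_spiral (mu z : C) (t : R) :
  is_path_derive (fun x => cexp_path mu x * z)%C t (mu * (cexp_path mu t * z))%C.
Proof.
replace (mu * (cexp_path mu t * z))%C with (mu * cexp_path mu t * z)%C by ring.
apply is_path_derive_scal, is_path_derive_cexp_path.
Qed.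

Lemma Cdot_mult (u v w : C) : Cdot (u * w) (v * w) = Cmod w ^ 2 * Cdot u v.
Proof. rewrite Cmod2_alt; unfold Cdot, Re, Im; simpl; ring. Qed.

(* Along the spiral [exp (t * conj lam) * z] the function
   [exp (2 * t * Re lam) * Cmod (F _) ^ 2] has a derivative of the sign of
   [Cmod (w F' + lam F) ^ 2 - Cmod (w F') ^ 2]. *)
Lemma spiral_nonvanishing (F F1 : C -> C) (lam z : C) :
  (forall w, Cmod w < 1 -> is_derive F w (F1 w)) ->
  Cmod lam ^ 2 = 2 * Re lam -> 0 < Re lam -> 0 < Cmod z < 1 ->
  (forall w, Cmod w <= Cmod z ->
     0 <= Cmod (w * F1 w + lam * F w)%C ^ 2 - Cmod (w * F1 w)%C ^ 2) ->
  (forall w, Cmod w < Cmod z ->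
     0 < Cmod (w * F1 w + lam * F w)%C ^ 2 - Cmod (w * F1 w)%C ^ 2) ->
  F z <> RtoC 0.
Proof.
intros HF Hl Hl0 Hz Hnn Hpos HFz.
set (mu := Cconj lam).
pose (p := fun t : R => (cexp_path mu t * z)%C).
assert (Hp : forall t, Cmod (p t) = exp (Re lam * t) * Cmod z).
{ intros t; unfold p; rewrite Cmod_mult, Cmod_cexp_path; unfold mu.
  now rewrite re_conj. }
assert (Hp1 : forall t, t <= 0 -> Cmod (p t) <= Cmod z).
{ intros t Ht; rewrite Hp.
  assert (exp (Re lam * t) <= 1) by (apply exp_le_1; nra).
  nra. }
pose (g := fun t => exp (2 * Re lam * t) * Cdot (F (p t)) (F (p t))).
pose (g1 := fun t => exp (2 * Re lam * t)
  * (Cmod (p t * F1 (p t) + lam * F (p t))%C ^ 2 - Cmod (p t * F1 (p t))%C ^ 2)).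
assert (Hg : forall t, t <= 0 -> is_derive g t (g1 t)).
{ intros t Ht; specialize (Hp1 t Ht).
  assert (D : is_path_derive (fun x => F (p x)) t (F1 (p t) * (mu * p t))%C).
  { apply is_path_derive_comp; [apply HF; lra|apply is_path_derive_spiral]. }
  assert (E := is_derive_Cdot _ _ _ _ _ D D).
  replace (g1 t) with
    (2 * Re lam * exp (2 * Re lam * t) * Cdot (F (p t)) (F (p t))
     + exp (2 * Re lam * t) * (Cdot (F1 (p t) * (mu * p t)) (F (p t))
                               + Cdot (F (p t)) (F1 (p t) * (mu * p t)))).
  - apply (is_derive_mult (K := R_AbsRing) (fun x => exp (2 * Re lam * x))
             (fun x => Cdot (F (p x)) (F (p x)))); [|exact E|exact Rmult_comm].
    auto_derive; [trivial|ring].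
  (* Since 2 Re lam = |lam|^2, the two terms of the derivative complete the square of w F' + lam
     F. *)
  - unfold g1; rewrite <- Hl, !Cmod2_alt; unfold mu, Cdot, Cconj, Re, Im; simpl; ring. }
(* As [g] is nonnegative and does not decrease towards g 0 = 0, the zero at [z] forces one at the
   interior point [p (-1)]. There the two moduli agree, against the strict inequality. *)
destruct (MVT_cor2 g g1 (-1) 0) as [c [Hc1 Hc2]]; [lra| |].
{ intros c Hc; apply is_derive_Reals, Hg; lra. }
assert (Hg1c : 0 <= g1 c).
{ apply Rmult_le_pos; [apply Rlt_le, exp_pos|apply Hnn, Hp1; lra]. }
assert (Hg0 : g 0 = 0).
{ unfold g, p; rewrite cexp_path_0, Cmult_1_l, HFz; unfold Cdot; simpl; ring. }
assert (HF0 : F (p (-1)) = RtoC 0).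
{ apply Cmod_eq_0.
  assert (He := exp_pos (2 * Re lam * -1)).
  assert (H1 : g (-1) <= 0) by lra.
  unfold g in H1; rewrite Cdot_Cmod in H1.
  assert (H2 := Cmod_ge_0 (F (p (-1)))).
  destruct H2 as [H2|H2]; [|now symmetry].
  assert (0 < Cmod (F (p (-1))) ^ 2) by (now apply pow_lt); nra. }
specialize (Hpos (p (-1))).
rewrite HF0, Cmult_0_r, Cplus_0_r in Hpos.
assert (Cmod (p (-1)) < Cmod z); [|specialize (Hpos ltac:(assumption)); lra].
rewrite Hp.
assert (exp (Re lam * -1) < 1) by (rewrite <- exp_0; apply exp_increasing; lra).
nra.
Qed.

(* With [q = z F' / F = (a, b)] and [y = z ^ 2 F'' / F], the last two hypotheses
   say that [conj (q + lam) * ((1 + lam) * q + y) - conj q * y] is real and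
   nonpositive; multiply it by [lam] and take real parts. *)
Lemma contact_inequality (a b L1 L2 y1 y2 : R) :
  0 < L1 -> L1 ^ 2 + L2 ^ 2 = 2 * L1 ->
  Cdot (a + L1, b + L2) (a + L1, b + L2) = Cdot (a, b) (a, b) ->
  let u := ((1 + (L1, L2)) * (a, b) + (y1, y2))%C in
  Cdot (a + L1, b + L2) u <= Cdot (a, b) (y1, y2) ->
  Cdot (a + L1, b + L2) (Ci * u)%C = Cdot (a, b) (Ci * (y1, y2))%C ->
  a + y1 - a ^ 2 + b ^ 2 + (a ^ 2 + b ^ 2) / 2 <= 0.
Proof.
intros HL E M u X1 X2; unfold u, Cdot, Ci, RtoC, Re, Im, Cmult, Cplus in *.
simpl in M, X1, X2; clear u.
set (x1 := (a + L1) * ((1 + L1) * a - L2 * b + y1)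
  + (b + L2) * ((1 + L1) * b + L2 * a + y2) - (a * y1 + b * y2)).
set (x2 := (a + L1) * ((1 + L1) * b + L2 * a + y2)
  - (b + L2) * ((1 + L1) * a - L2 * b + y1) - (a * y2 - b * y1)).
assert (H1 : x1 <= 0) by (unfold x1; lra).
assert (H2 : x2 = 0) by (unfold x2; lra).
assert (Hm : 2 * (L1 * a + L2 * b) + (L1 ^ 2 + L2 ^ 2) = 0) by lra.
assert (Id : L1 * x1 - L2 * x2 =
  (L1 ^ 2 + L2 ^ 2) * (a + y1 - a ^ 2 + b ^ 2) + L1 * (a ^ 2 + b ^ 2)
  + (2 * (L1 * a + L2 * b) + (L1 ^ 2 + L2 ^ 2)) * (L1 * a - L2 * b))
  by (unfold x1, x2; ring).
(* What remains is L1 x1 = 2 L1 (a + y1 - a^2 + b^2) + L1 (a^2 + b^2), to be divided by 2 L1 > 0. *)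
rewrite Hm, H2, E in Id; nra.
Qed.

(** Here w = k z / (1 - z) without its denominator. Multiplying by the conjugate of 1 - z gives Re w
    + k / 2 = k (1 - |z|^2) / (2 |1 - z|^2). *)
Lemma Re_halfplane (w1 w2 z1 z2 k : R) : 0 < k -> z1 ^ 2 + z2 ^ 2 < 1 ->
  (((w1, w2) : C) * (1 - ((z1, z2) : C)))%C = (RtoC k * (z1, z2))%C -> - k / 2 < w1.
Proof.
intros Hk Hz H; injection H as Hr Hi; simpl in Hr, Hi.
assert (Hr' := f_equal (Rmult (1 - z1)) Hr); assert (Hi' := f_equal (Rmult z2) Hi).
assert (E : (w1 + k / 2) * ((1 - z1) ^ 2 + z2 ^ 2) = k * (1 - (z1 ^ 2 + z2 ^ 2)) / 2)
  by lra.
assert (0 < (1 - z1) ^ 2 + z2 ^ 2) by nra.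
assert (0 < k * (1 - (z1 ^ 2 + z2 ^ 2))) by nra.
nra.
Qed.

(** Schwarz' lemma for z F1 / B: the maximum principle is applied to F1 / B, which is at most 1 / r
    on the circle. [F3] and [B2] supply the second derivative of this quotient. *)
Lemma ratio_bound (F1 F2 F3 B B1 B2 : C -> C) (r : R) : 0 < r ->
  (forall z, Cmod z <= r -> is_derive F1 z (F2 z)) ->
  (forall z, Cmod z <= r -> is_derive F2 z (F3 z)) ->
  (forall z, Cmod z <= r -> is_derive B z (B1 z)) ->
  (forall z, Cmod z <= r -> is_derive B1 z (B2 z)) ->
  (forall z, Cmod z <= r -> B z <> RtoC 0) ->
  (forall z, Cmod z = r -> Cmod (z * F1 z)%C <= Cmod (B z)) ->
  forall z, Cmod z <= r -> r * Cmod (F1 z) <= Cmod (B z).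
Proof.
intros Hr H1 H2 HB HB1 Hnz Hcirc z Hz.
assert (Dv : forall y, Cmod y <= r -> is_derive (fun x => F1 x / B x)%C y
  ((F2 y * B y - F1 y * B1 y) / (B y * B y))%C)
  by (intros; apply is_C_derive_div; auto).
assert (H : Cmod (F1 z / B z)%C <= / r).
{ apply (maximum_modulus (fun x => F1 x / B x)%C
    (fun y => (F2 y * B y - F1 y * B1 y) / (B y * B y))%C
    (fun y => (((F3 y * B y + F2 y * B1 y) + (- (1)) * (F2 y * B1 y + F1 y * B2 y))
        * (B y * B y) - (F2 y * B y - F1 y * B1 y) * (B1 y * B y + B y * B1 y))
       / ((B y * B y) * (B y * B y)))%C r).
  - intros y Hy; apply Dv; lra.
  - intros y Hy; assert (Hy' : Cmod y <= r) by lra.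
    apply (is_C_derive_div (fun x => F2 x * B x - F1 x * B1 x)%C
             (fun x => B x * B x)%C).
    + eapply is_derive_ext.
      2: { apply is_C_derive_plus; [apply is_C_derive_mult; auto|].
           apply is_C_derive_scal; apply is_C_derive_mult; auto. }
      intros x; simpl; ring.
    + apply is_C_derive_mult; auto.
    + apply Cmult_neq_0; auto.
  - intros y Hy; eapply is_C_derive_ccont, Dv, Hy.
  - intros y Hy.
    assert (HBy : 0 < Cmod (B y)) by (apply Cmod_gt_0, Hnz; lra).
    rewrite Cmod_div by (apply Hnz; lra).
    apply Rle_div_l; [assumption|].
    specialize (Hcirc y Hy); rewrite Cmod_mult, Hy in Hcirc.
    apply Rmult_le_reg_l with r; [assumption|].
    rewrite <- Rmult_assoc, Rinv_r, Rmult_1_l; lra.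
  - assumption. }
assert (HBz : 0 < Cmod (B z)) by (apply Cmod_gt_0; auto).
rewrite Cmod_div in H by auto.
apply Rle_div_l in H; [|assumption].
apply Rmult_le_reg_l with (/ r); [now apply Rinv_0_lt_compat|].
rewrite <- Rmult_assoc, Rinv_l, Rmult_1_l; lra.
Qed.

(* Differentiate [Cmod z0 ^ 2 * Cmod (F1 z) ^ 2 - Cmod (B z) ^ 2], which is
   maximal at [z0] on the closed disk, along the ray and the circle through
   [z0]. *)
Lemma contact_derivatives (F1 F2 B B1 : C -> C) (z0 : C) :
  0 < Cmod z0 ->
  is_derive F1 z0 (F2 z0) -> is_derive B z0 (B1 z0) ->
  (forall z, Cmod z <= Cmod z0 -> Cmod z0 * Cmod (F1 z) <= Cmod (B z)) ->
  Cmod z0 * Cmod (F1 z0) = Cmod (B z0) ->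
  Cdot (B z0) (B1 z0 * z0) <= Cdot (F1 z0 * z0) (F2 z0 * z0 * z0) /\
  Cdot (B z0) (Ci * (B1 z0 * z0)) = Cdot (F1 z0 * z0) (Ci * (F2 z0 * z0 * z0)).
Proof.
intros Hz0 D1 DB Hle Heq.
set (r := Cmod z0) in *.
pose (p := fun (mu : C) (t : R) => (cexp_path mu t * z0)%C).
assert (Hp0 : forall mu, p mu 0 = z0)
  by (intros; unfold p; rewrite cexp_path_0; ring).
pose (g := fun mu t => r ^ 2 * Cdot (F1 (p mu t)) (F1 (p mu t))
                       + (-1) * Cdot (B (p mu t)) (B (p mu t))).
assert (Hg0 : forall mu, g mu 0 = 0).
{ intros mu; unfold g; rewrite Hp0, !Cdot_Cmod, <- Heq; ring. }
assert (Hg : forall mu t, Re mu * t <= 0 -> g mu t <= g mu 0).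
{ intros mu t Ht; rewrite Hg0; unfold g; rewrite !Cdot_Cmod.
  assert (Hin : Cmod (p mu t) <= r).
  { unfold p; rewrite Cmod_mult, Cmod_cexp_path; fold r.
    assert (exp (Re mu * t) <= 1) by (now apply exp_le_1).
    nra. }
  specialize (Hle _ Hin).
  assert (H : (r * Cmod (F1 (p mu t))) ^ 2 <= Cmod (B (p mu t)) ^ 2).
  { apply pow_incr; split; [|assumption].
    apply Rmult_le_pos; [lra|apply Cmod_ge_0]. }
  rewrite Rpow_mult_distr in H; lra. }
assert (Hd : forall mu, is_derive (g mu) 0
  (2 * (Cdot (F1 z0 * z0) (mu * (F2 z0 * z0 * z0)) - Cdot (B z0) (mu * (B1 z0 * z0))))).
{ intros mu; unfold g.
  assert (P1 : is_path_derive (fun x => F1 (p mu x)) 0 (F2 z0 * (mu * z0))%C).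
  { rewrite <- (Hp0 mu) at 2.
    apply is_path_derive_comp; [now rewrite Hp0|apply is_path_derive_spiral]. }
  assert (P2 : is_path_derive (fun x => B (p mu x)) 0 (B1 z0 * (mu * z0))%C).
  { rewrite <- (Hp0 mu) at 2.
    apply is_path_derive_comp; [now rewrite Hp0|apply is_path_derive_spiral]. }
  assert (E1 := is_derive_Cdot _ _ _ _ _ P1 P1).
  assert (E2 := is_derive_Cdot _ _ _ _ _ P2 P2).
  cbv beta in E1, E2; rewrite (Hp0 mu) in E1, E2.
  apply (is_derive_scal _ _ (r ^ 2)) in E1; apply (is_derive_scal _ _ (-1)) in E2.
  assert (E := is_derive_plus _ _ _ _ _ E1 E2).
  replace (mu * (F2 z0 * z0 * z0))%C with (F2 z0 * (mu * z0) * z0)%C by ring.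
  (* The factor [z0] common to both arguments of [Cdot] accounts for the weight r^2. *)
  rewrite Cdot_mult; fold r.
  replace (mu * (B1 z0 * z0))%C with (B1 z0 * (mu * z0))%C by ring.
  match goal with |- is_derive _ _ ?l =>
    match type of E with is_derive _ _ ?l' => replace l with l' end end;
    [exact E|].
  unfold plus; simpl; unfold Cdot; ring. }
(* For mu = 1 only t <= 0 stays in the disk, which gives an inequality; for mu = i both signs of [t]
   do, which gives an equation. *)
split.
- assert (H := derive_left_max (g 1%C) _ 1 (Hd 1%C) Rlt_0_1).
  rewrite !Cmult_1_l in H.
  enough (0 <= 2 * (Cdot (F1 z0 * z0) (F2 z0 * z0 * z0) - Cdot (B z0) (B1 z0 * z0)))
    by lra.
  apply H; intros t Ht; apply Hg; simpl; lra.
- assert (H := derive_left_max (g Ci) _ 1 (Hd Ci) Rlt_0_1).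
  assert (H' := derive_right_max (g Ci) _ 1 (Hd Ci) Rlt_0_1).
  assert (Hi : forall t, g Ci t <= g Ci 0) by (intros; apply Hg; simpl; lra).
  specialize (H (fun t _ => Hi t)); specialize (H' (fun t _ => Hi t)); lra.
Qed.

(** For ([co], [si]) = (cos th, sin th), [lam] is 1 - exp (2 i th) by the double angle formulas, and
    changing the sign of [si] gives the other half-plane. The hypothesis on [rho] excludes contact
    at q = rho exp (i th) - 1. *)
Lemma halfplane_bound (F F1 F2 F3 : C -> C) (co si s k : R) :
  co ^ 2 + si ^ 2 = 1 -> si <> 0 -> 0 < k ->
  (forall z, Cmod z < 1 -> is_derive F z (F1 z)) ->
  (forall z, Cmod z < 1 -> is_derive F1 z (F2 z)) ->
  (forall z, Cmod z < 1 -> is_derive F2 z (F3 z)) ->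
  F (RtoC 0) <> RtoC 0 ->
  (forall z, Cmod z < 1 -> let G := (z * F2 z + RtoC (2 * s + 1) * F1 z)%C in
     G = (z * G + RtoC k * F z)%C) ->
  (forall rho, let a := rho * co - 1 in let b := rho * si in
     a ^ 2 - b ^ 2 + 2 * s * a + k / 2 <= (a ^ 2 + b ^ 2) / 2) ->
  let lam : C := (2 * si ^ 2, - 2 * co * si) in
  forall z, Cmod z < 1 ->
    0 < Cmod (z * F1 z + lam * F z)%C ^ 2 - Cmod (z * F1 z)%C ^ 2.
Proof.
intros Hcs Hsi Hk D0 D1 D2 HF0 ODE Hell lam z Hz.
assert (Hl0 : 0 < Re lam) by (simpl; nra).
assert (Hl2 : Cmod lam ^ 2 = 2 * Re lam).
{ rewrite Cmod2_alt; unfold lam, Re, Im; simpl.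
  transitivity (4 * si ^ 2 * (co ^ 2 + si ^ 2)); [ring|rewrite Hcs; ring]. }
assert (Hlnz : lam <> RtoC 0) by (intros E; rewrite E in Hl0; simpl in Hl0; lra).
pose (B := fun y => (y * F1 y + lam * F y)%C).
pose (B1 := fun y => ((F1 y + y * F2 y) + lam * F1 y)%C).
pose (B2 := fun y => ((F2 y + (F2 y + y * F3 y)) + lam * F2 y)%C).
assert (DB : forall y, Cmod y < 1 -> is_derive B y (B1 y)).
{ intros y Hy; apply is_C_derive_plus; [apply is_C_derive_id_mult; auto|].
  apply is_C_derive_scal; auto. }
assert (DB1 : forall y, Cmod y < 1 -> is_derive B1 y (B2 y)).
{ intros y Hy; apply is_C_derive_plus; [apply is_C_derive_plus|];
    [auto|apply is_C_derive_id_mult; auto|apply is_C_derive_scal; auto]. }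
pose (D := fun y => Cmod (B y) ^ 2 + (-1) * Cmod (y * F1 y)%C ^ 2).
assert (HDeq : forall y, Cmod (y * F1 y + lam * F y)%C ^ 2 - Cmod (y * F1 y)%C ^ 2 = D y)
  by (intros; unfold D, B; ring).
rewrite HDeq; apply Rnot_le_lt; intros Hneg.
destruct (first_contact D) as [z0 [Hz0 [HDz0 [Hpos Hnn]]]].
{ intros y Hy; apply rcont_lin; apply rcont_Cmod2; eapply is_C_derive_ccont;
    [now apply DB|apply is_C_derive_id_mult; auto]. }
{ unfold D, B; rewrite !Cmult_0_l, Cplus_0_l, Cmod_0, Cmod_mult.
  assert (0 < Cmod lam) by (now apply Cmod_gt_0).
  assert (0 < Cmod (F (RtoC 0))) by (now apply Cmod_gt_0).
  assert (0 < (Cmod lam * Cmod (F (RtoC 0))) ^ 2)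
    by (apply pow_lt, Rmult_lt_0_compat; assumption); lra. }
{ now exists z. }
(* On the contact circle only [0 <= D] is known, which allows F = 0; the spiral rules this out.
   Hence q is defined at [z0], and [B] has no zero in the closed disk. *)
assert (HF : forall y, Cmod y = Cmod z0 -> F y <> RtoC 0).
{ intros y Hy; apply (spiral_nonvanishing F F1 lam y); auto; [lra| |];
    intros w Hw; rewrite HDeq; rewrite Hy in Hw; auto. }
assert (HBnz : forall y, Cmod y <= Cmod z0 -> B y <> RtoC 0).
{ intros y Hy HB0.
  assert (HN : Cmod (y * F1 y)%C ^ 2 <= 0).
  { specialize (Hnn y Hy); unfold D in Hnn; rewrite HB0, Cmod_0 in Hnn; lra. }
  assert (HN0 : (y * F1 y)%C = RtoC 0).
  { apply Cmod_eq_0; generalize (Cmod_ge_0 (y * F1 y)%C); nra. }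
  destruct Hy as [Hy|Hy].
  - specialize (Hpos y Hy); unfold D in Hpos; rewrite HB0, HN0, Cmod_0 in Hpos; lra.
  - unfold B in HB0; rewrite HN0, Cplus_0_l in HB0.
    now apply (Cmult_neq_0 lam (F y) Hlnz (HF y Hy)). }
assert (Hle : forall y, Cmod y <= Cmod z0 -> Cmod z0 * Cmod (F1 y) <= Cmod (B y)).
{ apply (ratio_bound F1 F2 F3 B B1 B2); try (intros; auto; fail); try lra;
    try (intros y Hy; first [apply D1|apply D2|apply DB|apply DB1]; lra).
  intros y Hy; assert (H := Hnn y ltac:(lra)); unfold D in H.
  apply Rnot_lt_le; intros Hlt.
  generalize (Cmod_ge_0 (B y)); nra. }
assert (Heq : Cmod z0 * Cmod (F1 z0) = Cmod (B z0)).
{ unfold D in HDz0; rewrite Cmod_mult in HDz0.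
  apply Rsqr_inj; [apply Rmult_le_pos; apply Cmod_ge_0|apply Cmod_ge_0|].
  rewrite !Rsqr_pow2; lra. }
destruct (contact_derivatives F1 F2 B B1 z0) as [X1 X2]; auto; try lra;
  [apply D1; lra|apply DB; lra|].
assert (HFz := HF z0 eq_refl).
(* All contact relations are homogeneous in F, F', F''; dividing by [F z0] leaves only q and y. *)
pose (q := (z0 * F1 z0 / F z0)%C); pose (y := (z0 * z0 * F2 z0 / F z0)%C).
assert (EN : (F1 z0 * z0)%C = (q * F z0)%C) by (unfold q; field; assumption).
assert (EY : (F2 z0 * z0 * z0)%C = (y * F z0)%C) by (unfold y; field; assumption).
assert (EB : B z0 = ((q + lam) * F z0)%C) by (unfold B, q; field; assumption).
assert (EB1 : (B1 z0 * z0)%C = (((1 + lam) * q + y) * F z0)%C)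
  by (unfold B1, q, y; field; assumption).
assert (HFm : 0 < Cmod (F z0) ^ 2) by (apply pow_lt; now apply Cmod_gt_0).
rewrite EN, EY, EB, EB1, !Cdot_mult in X1.
rewrite EN, EY, EB, EB1, !(Cmult_assoc Ci), !Cdot_mult in X2.
apply Rmult_le_reg_l in X1; [|assumption].
apply Rmult_eq_reg_l in X2; [|lra].
assert (HM : Cdot (q + lam) (q + lam) = Cdot q q).
{ apply Rmult_eq_reg_l with (Cmod (F z0) ^ 2); [|lra].
  rewrite <- !Cdot_mult, <- EB, <- EN, !Cdot_Cmod, <- Heq, Cmod_mult; ring. }
(* The differential equation multiplied by z0 / F z0. *)
assert (HODE : ((y + RtoC (2 * s + 1) * q) * (1 - z0) = RtoC k * z0)%C).
{ assert (H := ODE z0 ltac:(lra)); simpl in H.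
  assert (E : (z0 * (z0 * F2 z0 + RtoC (2 * s + 1) * F1 z0) * (1 - z0)
               = RtoC k * z0 * F z0)%C).
  { transitivity (z0 * ((z0 * F2 z0 + RtoC (2 * s + 1) * F1 z0)
      - z0 * (z0 * F2 z0 + RtoC (2 * s + 1) * F1 z0)))%C; [ring|].
    rewrite H at 1; ring. }
  unfold y, q.
  transitivity (z0 * (z0 * F2 z0 + RtoC (2 * s + 1) * F1 z0) * (1 - z0) / F z0)%C;
    [field; assumption|].
  rewrite E; field; assumption. }
clear EN EY EB EB1.
assert (Hz0m : Cmod z0 ^ 2 < 1) by nra.
rewrite Cmod2_alt in Hz0m.
destruct z0 as [z1 z2], q as [a b], y as [y1 y2].
assert (HW := Re_halfplane (y1 + (2 * s + 1) * a) (y2 + (2 * s + 1) * b) z1 z2 k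
                Hk Hz0m).
assert (HW' : - k / 2 < y1 + (2 * s + 1) * a).
{ apply HW; rewrite <- HODE; f_equal; unfold Cplus, Cmult, RtoC; simpl; f_equal; ring. }
assert (HC := contact_inequality a b (2 * si ^ 2) (- 2 * co * si) y1 y2 Hl0).
assert (HE : (2 * si ^ 2) ^ 2 + (- 2 * co * si) ^ 2 = 2 * (2 * si ^ 2))
  by (rewrite Cmod2_alt in Hl2; exact Hl2).
specialize (HC HE HM X1 X2).
(* |q + lam| = |q| reads 4 si (si (a + 1) - co b) = 0: the point 1 + q lies on the line through 0
   with direction (co, si). *)
assert (Hlin : si * (a + 1) = co * b).
{ unfold Cdot, lam in HM; simpl in HM.
  apply Rmult_eq_reg_l with (4 * si); [|lra].
  simpl in HE; lra. }
(* [rho] is the coordinate of 1 + q on that line, its scalar product with (co, si). *)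
specialize (Hell (co * (a + 1) + si * b)); simpl in Hell.
replace ((co * (a + 1) + si * b) * co - 1) with a in Hell.
2: { transitivity ((co ^ 2 + si ^ 2) * (a + 1) - 1);
       [rewrite Hcs; ring|].
     transitivity (co ^ 2 * (a + 1) + si * (si * (a + 1)) - 1); [ring|].
     rewrite Hlin; ring. }
replace ((co * (a + 1) + si * b) * si) with b in Hell.
2: { transitivity ((co ^ 2 + si ^ 2) * b); [rewrite Hcs; ring|].
     transitivity (co * (co * b) + si ^ 2 * b); [ring|].
     rewrite <- Hlin; ring. }
(* Eliminating [y1] between [HC] and the strict [HW'] contradicts [Hell]. *)
lra.
Qed.

(** * The hypergeometric series *)

(** The coefficients are real because (s + i t + n) (s - i t + n) = (s + n)^2 + t^2. *)
Fixpoint hyp_coeff (s t : R) (n : nat) : R :=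
  match n with
  | O => 1
  | S m => hyp_coeff s t m * (((s + INR m) ^ 2 + t ^ 2)
                              / ((2 * s + 1 + INR m) * (INR m + 1)))
  end.

Lemma hyp_coeff_rec (s t : R) (n : nat) : 0 < s ->
  (INR n + 1) * (2 * s + 1 + INR n) * hyp_coeff s t (S n)
  = ((s + INR n) ^ 2 + t ^ 2) * hyp_coeff s t n.
Proof.
intros Hs; assert (Hn := pos_INR n).
change (hyp_coeff s t (S n)) with
  (hyp_coeff s t n * (((s + INR n) ^ 2 + t ^ 2) / ((2 * s + 1 + INR n) * (INR n + 1)))).
field; lra.
Qed.

Lemma hyp_coeff_nonneg (s t : R) (n : nat) : 0 < s -> 0 <= hyp_coeff s t n.
Proof.
intros Hs; induction n as [|n IH]; [simpl; lra|].
assert (Hn := pos_INR n).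
apply Rmult_le_pos; [assumption|]; apply Rdiv_le_0_compat; [|apply Rmult_lt_0_compat; lra].
generalize (pow2_ge_0 (s + INR n)) (pow2_ge_0 t); lra.
Qed.

(** As (2 s + 1 + n) (n + 1) - (s + n)^2 - t^2 = 2 n + 2 s + 1 - s^2 - t^2, the coefficients do not
    increase from [n0] on. Boundedness gives a radius of convergence of at least 1. *)
Lemma hyp_coeff_bounded (s t : R) : 0 < s -> exists M, forall n, hyp_coeff s t n <= M.
Proof.
intros Hs.
destruct (INR_archimed 1 (s ^ 2 + t ^ 2) Rlt_0_1) as [n0 Hn0].
assert (Hfin : exists M, forall n, (n <= n0)%nat -> hyp_coeff s t n <= M).
{ clear Hn0; induction n0 as [|n0 [M HM]].
  - exists 1; intros n Hn; replace n with O by lia; simpl; lra.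
  - exists (Rmax M (hyp_coeff s t (S n0))); intros n Hn.
    destruct (Nat.eq_dec n (S n0)) as [->|Hne]; [apply Rmax_r|].
    eapply Rle_trans; [apply HM; lia|apply Rmax_l]. }
destruct Hfin as [M HM]; exists M; intros n.
destruct (Nat.le_gt_cases n n0) as [H|H]; [now apply HM|].
replace n with (n0 + (n - n0))%nat by lia; generalize (n - n0)%nat; clear n H.
induction n as [|n IH]; [rewrite Nat.add_0_r; now apply HM|].
apply Rle_trans with (2 := IH); rewrite Nat.add_succ_r.
assert (Hn := pos_INR n); assert (Hn0' := pos_INR n0).
assert (Hnn := hyp_coeff_nonneg s t (n0 + n) Hs).
simpl hyp_coeff; rewrite <- (Rmult_1_r (hyp_coeff s t (n0 + n))) at 2.
apply Rmult_le_compat_l; [assumption|].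
rewrite plus_INR; apply Rle_div_l; [apply Rmult_lt_0_compat; lra|]; nra.
Qed.

Lemma disk_coeffs_hyp (s t : R) : 0 < s -> disk_coeffs (hyp_coeff s t).
Proof.
intros Hs; split; [intros; now apply hyp_coeff_nonneg|].
destruct (hyp_coeff_bounded s t Hs) as [M HM].
apply (proj1 (CV_radius_bounded (hyp_coeff s t))); exists M; intros n.
rewrite pow1, Rmult_1_r, Rabs_pos_eq; [apply HM|now apply hyp_coeff_nonneg].
Qed.

Lemma hyp2F1_CPS (s t : R) (z : C) : 0 < s ->
  hyp2F1 (RtoC s + Ci * RtoC t) (RtoC s - Ci * RtoC t) (RtoC (2 * s + 1)) z
  = CPS (hyp_coeff s t) z.
Proof.
intros Hs; apply CSeries_ext; intros n; f_equal.
(* The quotient is cleared of its denominator for the induction; 2 s + 1 + m > 0 keeps that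
   denominator from vanishing. *)
assert (Hnz : forall m, pochhammer (RtoC (2 * s + 1)) m <> RtoC 0 /\
  (pochhammer (RtoC s + Ci * RtoC t) m * pochhammer (RtoC s - Ci * RtoC t) m
   = RtoC (hyp_coeff s t m)
     * (pochhammer (RtoC (2 * s + 1)) m * RtoC (INR (fact m))))%C).
{ induction m as [|m [IH1 IH2]].
  - split; [exact C1_nz|]; simpl; ring.
  - assert (Hm := pos_INR m).
    assert (Hc : (RtoC (2 * s + 1) + RtoC (INR m))%C <> RtoC 0).
    { rewrite <- RtoC_plus; intros E; apply RtoC_inj in E; lra. }
    split; [now apply Cmult_neq_0|].
    change (fact (S m)) with (S m * fact m)%nat; rewrite mult_INR, S_INR, RtoC_mult.
    assert (Hrec := hyp_coeff_rec s t m Hs).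
    simpl pochhammer.
    transitivity (RtoC ((s + INR m) ^ 2 + t ^ 2)
      * (pochhammer (RtoC s + Ci * RtoC t) m * pochhammer (RtoC s - Ci * RtoC t) m))%C.
    + replace (RtoC ((s + INR m) ^ 2 + t ^ 2)) with
        ((RtoC s + Ci * RtoC t + RtoC (INR m)) * (RtoC s - Ci * RtoC t + RtoC (INR m)))%C
        by (unfold RtoC, Ci, Cminus, Copp, Cplus, Cmult; simpl; f_equal; ring).
      ring.
    + rewrite IH2, Cmult_assoc, <- RtoC_mult, <- Hrec, !RtoC_mult, <- !RtoC_plus.
      replace (2 * s + 1 + INR m) with (INR m + (2 * s + 1)) by ring.
      rewrite !RtoC_plus; ring. }
destruct (Hnz n) as [H1 H2]; rewrite H2; field.
split; [|assumption].
intros E; apply RtoC_inj in E; now apply INR_fact_neq_0 in E.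
Qed.

Lemma CPS_ext (a b : nat -> R) (z : C) : (forall n, a n = b n) -> CPS a z = CPS b z.
Proof. intros H; apply CSeries_ext; intros n; now rewrite H. Qed.

Lemma CPS_plus (a b : nat -> R) (z : C) : disk_coeffs a -> disk_coeffs b -> Cmod z < 1 ->
  CPS (PS_plus a b) z = (CPS a z + CPS b z)%C.
Proof.
intros Ha Hb Hz; unfold CPS; rewrite <- CSeries_plus by now apply CPS_cv.
apply CSeries_ext; intros n; unfold PS_plus, plus; simpl; rewrite RtoC_plus; ring.
Qed.

Lemma CPS_scal (k : R) (a : nat -> R) (z : C) : disk_coeffs a -> Cmod z < 1 ->
  CPS (PS_scal k a) z = (RtoC k * CPS a z)%C.
Proof.
intros Ha Hz; unfold CPS; rewrite <- CSeries_scal by now apply CPS_cv.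
apply CSeries_ext; intros n; unfold PS_scal, scal; simpl; unfold mult; simpl.
rewrite RtoC_mult; ring.
Qed.

Lemma disk_coeffs_plus (a b : nat -> R) :
  disk_coeffs a -> disk_coeffs b -> disk_coeffs (PS_plus a b).
Proof.
intros [Ha Ra] [Hb Rb]; split.
- intros n; apply Rplus_le_le_0_compat; auto.
- eapply Rbar_le_trans; [|apply CV_radius_plus].
  unfold Rbar_min; destruct (CV_radius a), (CV_radius b); simpl in *; trivial.
  now apply Rmin_glb.
Qed.

Lemma disk_coeffs_scal (k : R) (a : nat -> R) :
  0 < k -> disk_coeffs a -> disk_coeffs (PS_scal k a).
Proof.
intros Hk [Ha Ra]; split.
- intros n; apply Rmult_le_pos; [lra|apply Ha].
- rewrite CV_radius_scal by lra; assumption.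
Qed.

Lemma disk_coeffs_incr_1 (a : nat -> R) : disk_coeffs a -> disk_coeffs (PS_incr_1 a).
Proof.
intros [Ha Ra]; split; [|now rewrite CV_radius_incr_1].
intros [|n]; [apply Rle_refl|apply Ha].
Qed.

Lemma CPS_incr_1 (a : nat -> R) (z : C) : disk_coeffs a -> Cmod z < 1 ->
  CPS (PS_incr_1 a) z = (z * CPS a z)%C.
Proof.
intros Ha Hz; unfold CPS.
rewrite CSeries_incr_1 by (apply CPS_cv; [now apply disk_coeffs_incr_1|assumption]).
rewrite <- CSeries_scal by now apply CPS_cv.
replace (RtoC (PS_incr_1 a 0) * z ^ 0)%C with (RtoC 0) by (simpl; unfold zero; simpl; ring).
rewrite Cplus_0_l; apply CSeries_ext; intros n; simpl; ring.
Qed.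

(* The hypergeometric equation for [c = a + b + 1]. *)
Lemma hyp_ode (s t : R) (z : C) : 0 < s -> Cmod z < 1 ->
  let F := CPS (hyp_coeff s t) z in
  let F1 := CPS (PS_derive (hyp_coeff s t)) z in
  let F2 := CPS (PS_derive (PS_derive (hyp_coeff s t))) z in
  let G := (z * F2 + RtoC (2 * s + 1) * F1)%C in
  G = (z * G + RtoC (s ^ 2 + t ^ 2) * F)%C.
Proof.
intros Hs Hz; simpl.
set (a := hyp_coeff s t).
assert (Ha : disk_coeffs a) by now apply disk_coeffs_hyp.
assert (Ha1 := disk_coeffs_derive _ Ha); assert (Ha2 := disk_coeffs_derive _ Ha1).
assert (Hk : 0 < s * (s * 1) + t * (t * 1)) by nra.
pose (g := PS_plus (PS_incr_1 (PS_derive (PS_derive a)))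
             (PS_scal (2 * s + 1) (PS_derive a)) : nat -> R).
assert (Dg : disk_coeffs g).
{ apply disk_coeffs_plus; [now apply disk_coeffs_incr_1|].
  apply disk_coeffs_scal; [lra|assumption]. }
assert (Eg : CPS g z = (z * CPS (PS_derive (PS_derive a)) z
                        + RtoC (2 * s + 1) * CPS (PS_derive a) z)%C).
{ unfold g; rewrite CPS_plus, CPS_incr_1, CPS_scal; auto;
    [now apply disk_coeffs_incr_1|apply disk_coeffs_scal; [lra|assumption]]. }
rewrite <- Eg, <- CPS_incr_1, <- CPS_scal, <- CPS_plus;
  auto using disk_coeffs_incr_1, disk_coeffs_scal.
apply CPS_ext.
(* By the recurrence g_n = ((s + n)^2 + t^2) a_n, while g_(n-1) = n (2 s + n) a_n; the difference is
   (s^2 + t^2) a_n, which is the equation coefficient by coefficient. *)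
assert (Hg : forall n, g n = (INR n + 1) * (2 * s + 1 + INR n) * a (S n)).
{ intros [|n].
  - change (g O) with (0 + (2 * s + 1) * (1 * a 1%nat)); simpl INR; ring.
  - change (g (S n)) with (INR (S n) * (INR (S (S n)) * a (S (S n)))
      + (2 * s + 1) * (INR (S (S n)) * a (S (S n)))).
    rewrite !S_INR; ring. }
intros n; match goal with |- ?x = ?y => change (x = y :> R) end; revert n.
intros [|n]; rewrite Hg; unfold a at 1; rewrite hyp_coeff_rec by assumption; fold a.
- change (PS_plus (PS_incr_1 g) (PS_scal (s * (s * 1) + t * (t * 1)) a) O)
    with (0 + (s * (s * 1) + t * (t * 1)) * a O).
  simpl INR; ring.
- change (PS_plus (PS_incr_1 g) (PS_scal (s * (s * 1) + t * (t * 1)) a) (S n))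
    with (g n + (s * (s * 1) + t * (t * 1)) * a (S n)).
  rewrite Hg, S_INR; ring.
Qed.

(* Twice [4 * si ^ 2 - 1] times the difference of the two sides is a square plus
   three times the slack in the equation of the ellipse. *)
Lemma ellipse_inequality (co si s t rho : R) :
  co ^ 2 + si ^ 2 = 1 -> 1 / 4 < si ^ 2 ->
  (s - 2 * si ^ 2) ^ 2 + 1 / 3 * (4 * si ^ 2 - 1) * t ^ 2 <= si ^ 2 * (4 * si ^ 2 - 1) ->
  let a := rho * co - 1 in let b := rho * si in
  a ^ 2 - b ^ 2 + 2 * s * a + (s ^ 2 + t ^ 2) / 2 <= (a ^ 2 + b ^ 2) / 2.
Proof.
intros Hcs Hsi H; simpl.
set (S := si ^ 2) in *.
assert (HS : co ^ 2 = 1 - S) by lra.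
assert (Id : 2 * (4 * S - 1)
    * (((rho * co - 1) ^ 2 + rho ^ 2 * S) / 2
       - ((rho * co - 1) ^ 2 - rho ^ 2 * S + 2 * s * (rho * co - 1) + (s ^ 2 + t ^ 2) / 2))
  = (2 * co * s - rho * (4 * S - 1) - co) ^ 2
    + 3 * (S * (4 * S - 1) - ((s - 2 * S) ^ 2 + 1 / 3 * (4 * S - 1) * t ^ 2))).
{ replace S with (1 - co ^ 2) by lra; field. }
assert (Hsq := pow2_ge_0 (2 * co * s - rho * (4 * S - 1) - co)).
assert (Eb : (rho * si) ^ 2 = rho ^ 2 * S) by (unfold S; ring).
simpl in Eb; rewrite Eb.
apply Rminus_le_0, Rmult_le_reg_l with (2 * (4 * S - 1)); [lra|].
rewrite Rmult_0_r; simpl in Id, Hsq |- *; lra.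
Qed.

(** * From half-planes to the sector *)

Lemma Carg_sector (p : C) (th : R) : 0 < th < PI / 2 ->
  Rabs (Im p) * cos th < Re p * sin th -> p <> RtoC 0 /\ Rabs (Carg p) < th.
Proof.
intros Hth H.
assert (Hc : 0 < cos th) by (apply cos_gt_0; lra).
assert (Hs : 0 < sin th) by (apply sin_gt_0; lra).
assert (Hi := Rabs_pos (Im p)).
assert (Hx : 0 < Re p) by nra.
assert (Hp : p <> RtoC 0) by (intros ->; simpl in Hx; lra).
split; [assumption|].
destruct (Carg_spec p Hp) as [Hb [Hre _]].
assert (Hm : 0 < Cmod p) by (now apply Cmod_gt_0).
(* Comparing cosines is enough, as cosine is even and decreasing on [0, PI]; cos th |p| < Re p is
   the hypothesis after squaring. *)
assert (Hcos : cos th < cos (Carg p)).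
{ apply Rmult_lt_reg_l with (Cmod p); [assumption|]; rewrite <- Hre.
  apply Rsqr_incrst_0; [|apply Rmult_le_pos; lra|lra].
  rewrite !Rsqr_pow2, Rpow_mult_distr, Cmod2_alt.
  assert (E := sin2_cos2 th); rewrite !Rsqr_pow2 in E.
  assert (Ha : Rabs (Im p) ^ 2 = Im p ^ 2) by apply pow2_abs.
  assert (Hsq : (Rabs (Im p) * cos th) ^ 2 < (Re p * sin th) ^ 2).
  { assert (0 <= Rabs (Im p) * cos th) by (apply Rmult_le_pos; lra); nra. }
  rewrite !Rpow_mult_distr, Ha in Hsq.
  replace (sin th ^ 2) with (1 - cos th ^ 2) in Hsq by lra; lra. }
apply cos_decreasing_0; try lra.
- apply Rabs_pos.
- apply Rabs_le_between; lra.
- unfold Rabs; destruct Rcase_abs; [now rewrite cos_neg|assumption].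
Qed.

(** 1 - lam is the mirror image of 1 in the line through 0 with direction (co, si), so a point p
    nearer to 1 than to 1 - lam lies on the side of 1. *)
Lemma halfplane_quotient (N F : C) (co si : R) : co ^ 2 + si ^ 2 = 1 -> 0 < si ^ 2 ->
  let lam : C := (2 * si ^ 2, - 2 * co * si) in
  0 < Cmod (N + lam * F)%C ^ 2 - Cmod N ^ 2 ->
  F <> RtoC 0 /\ 0 < si * (si * Re (1 + N / F)%C - co * Im (1 + N / F)%C).
Proof.
intros Hcs Hsi lam H.
assert (HF : F <> RtoC 0).
{ intros E; rewrite E, Cmult_0_r, Cplus_0_r in H; lra. }
split; [assumption|].
set (p := (1 + N / F)%C).
replace N with ((p - 1) * F)%C in H by (unfold p; field; assumption).
replace ((p - 1) * F + lam * F)%C with ((p - 1 + lam) * F)%C in H by ring.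
rewrite !Cmod_mult, !Rpow_mult_distr, !Cmod2_alt in H.
assert (HFm : 0 < Cmod F ^ 2) by (apply pow_lt; now apply Cmod_gt_0).
rewrite Cmod2_alt in HFm.
set (m := Re F ^ 2 + Im F ^ 2) in *.
assert (Id : Re (p - 1 + lam)%C ^ 2 + Im (p - 1 + lam)%C ^ 2
  - (Re (p - 1)%C ^ 2 + Im (p - 1)%C ^ 2)
  = 4 * (si * (si * Re p - co * Im p)) + 4 * si ^ 2 * (co ^ 2 + si ^ 2 - 1)).
{ unfold lam, Re, Im; simpl; ring. }
rewrite Hcs in Id.
assert (H' : 0 < (4 * (si * (si * Re p - co * Im p))) * m).
{ replace (4 * (si * (si * Re p - co * Im p))) with
   (4 * (si * (si * Re p - co * Im p)) + 4 * si ^ 2 * (1 - 1)) by ring.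
  rewrite <- Id; lra. }
apply Rmult_lt_reg_r with m; [assumption|]; lra.
Qed.

Theorem corollary1p8 :
  forall alpha s t : R,
  1 / 3 < alpha < 1 ->
  (s - 2 * sin (PI * alpha / 2) ^ 2) ^ 2
    + 1 / 3 * (4 * sin (PI * alpha / 2) ^ 2 - 1) * t ^ 2
    <= sin (PI * alpha / 2) ^ 2 * (4 * sin (PI * alpha / 2) ^ 2 - 1) ->
  strongly_starlike alpha
    (fun z : C =>
       (z * hyp2F1 (RtoC s + Ci * RtoC t) (RtoC s - Ci * RtoC t)
              (RtoC (2 * s + 1)) z)%C).
Proof.
intros alpha s t Ha Hell.
assert (HPI := PI_RGT_0).
set (th := PI * alpha / 2) in *.
(* The bound alpha > 1 / 3 is what makes 4 sin^2 th - 1 positive. *)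
assert (Hth : PI / 6 < th < PI / 2) by (unfold th; nra).
assert (Hsin : 1 / 2 < sin th) by (rewrite <- sin_PI6; apply sin_increasing_1; lra).
assert (Hsin2 : 1 / 4 < sin th ^ 2) by nra.
assert (Hcs : cos th ^ 2 + sin th ^ 2 = 1)
  by (generalize (sin2_cos2 th); rewrite !Rsqr_pow2; lra).
(* With S = sin^2 th, (s - 2 S)^2 <= S (4 S - 1) < (2 S)^2. *)
assert (Hs : 0 < s) by (generalize (pow2_ge_0 t); nra).
assert (Hk : 0 < s ^ 2 + t ^ 2) by (generalize (pow2_ge_0 t); nra).
assert (HA := disk_coeffs_hyp s t Hs).
pose (F := CPS (hyp_coeff s t)).
pose (F1 := CPS (PS_derive (hyp_coeff s t))).
pose (F2 := CPS (PS_derive (PS_derive (hyp_coeff s t)))).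
pose (F3 := CPS (PS_derive (PS_derive (PS_derive (hyp_coeff s t))))).
assert (D0 : forall z, Cmod z < 1 -> is_derive F z (F1 z))
  by (intros; now apply is_C_derive_CPS).
assert (D1 : forall z, Cmod z < 1 -> is_derive F1 z (F2 z))
  by (intros; apply is_C_derive_CPS; auto using disk_coeffs_derive).
assert (D2 : forall z, Cmod z < 1 -> is_derive F2 z (F3 z))
  by (intros; apply is_C_derive_CPS; auto using disk_coeffs_derive).
assert (HF0 : F (RtoC 0) = RtoC 1) by (now apply CPS_0).
set (f := fun z : C => (z * hyp2F1 (RtoC s + Ci * RtoC t) (RtoC s - Ci * RtoC t)
                              (RtoC (2 * s + 1)) z)%C).
assert (Ef : forall z, f z = (z * F z)%C)
  by (intros; unfold f; now rewrite hyp2F1_CPS).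
assert (Df : forall z, Cmod z < 1 -> is_derive f z (F z + z * F1 z)%C).
{ intros z Hz; apply (is_derive_ext (fun y => y * F y)%C); [intros; now rewrite Ef|].
  apply is_C_derive_id_mult; auto. }
(* Only the square of the sine enters the ellipse, so [si] may be sin th or - sin th: one half-plane
   each. *)
assert (Hhalf : forall si z, si ^ 2 = sin th ^ 2 -> Cmod z < 1 ->
  F z <> RtoC 0 /\ 0 < si * (si * Re (1 + z * F1 z / F z)%C
                             - cos th * Im (1 + z * F1 z / F z)%C)).
{ intros si z Esi Hz; rewrite <- Esi in Hcs, Hsin2, Hell.
  apply halfplane_quotient; [assumption|lra|].
  apply (halfplane_bound F F1 F2 F3 (cos th) si s (s ^ 2 + t ^ 2)); auto.
  - intros E; rewrite E in Hsin2; lra.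
  - rewrite HF0; exact C1_nz.
  - intros w Hw; now apply hyp_ode.
  - intros rho; now apply ellipse_inequality. }
split; [|split; [|split]].
- intros z Hz; eexists; now apply Df.
- rewrite Ef; ring.
- apply is_C_derive_unique.
  replace (RtoC 1) with (F (RtoC 0) + RtoC 0 * F1 (RtoC 0))%C by (rewrite HF0; ring).
  apply Df; rewrite Cmod_0; lra.
- intros z Hz.
  destruct (Hhalf (sin th) z eq_refl Hz) as [HF H1].
  destruct (Hhalf (- sin th) z ltac:(ring) Hz) as [_ H2].
  split; [intros Hz0; rewrite Ef; now apply Cmult_neq_0|].
  replace (starlike_quotient f z) with (1 + z * F1 z / F z)%C.
  + replace (PI / 2 * alpha) with th by (unfold th; field).
    apply Carg_sector; [lra|].
    assert (K1 : cos th * Im (1 + z * F1 z / F z)%C < sin th * Re (1 + z * F1 z / F z)%C)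
      by nra.
    assert (K2 : - (cos th * Im (1 + z * F1 z / F z)%C)
                 < sin th * Re (1 + z * F1 z / F z)%C) by nra.
    unfold Rabs; destruct Rcase_abs; lra.
  (* As F 0 = 1, the formula 1 + z F' / F takes at 0 the prescribed value 1. *)
  + unfold starlike_quotient; destruct (Ceq_dec z (RtoC 0)) as [->|Hz0].
    * field; rewrite HF0; exact C1_nz.
    * rewrite (is_C_derive_unique _ _ _ (Df z Hz)), Ef; field; auto.
Qed.
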